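(* The class of reproducing kernel Hilbert algebras (RKHAs) is closed under the tensor product $\otimes$, the direct sum $\oplus$, pullbacks and pushouts: if $\mathcal H_1\subset\mathcal L(X_1)$, $\mathcal H_2\subset\mathcal L(X_2)$ and $\mathcal H(k)\subset\mathcal L(X)$ are RKHAs, then $\mathcal H_1\otimes\mathcal H_2\subset\mathcal L(X_1\times X_2)$ and $\mathcal H_1\oplus\mathcal H_2\subset\mathcal L(X_1\sqcup X_2)$ are RKHAs, for every map $\phi\colon S\to X$ the pullback $\mathcal H(k\circ\phi)\subset\mathcal L(S)$ is an RKHA, and for every map $\phi\colon X\to S$ the pushout $\mathcal H(k_\phi)\subset\mathcal L(S)$ is an RKHA. Additionally, the class of unital RKHAs is closed under these operations.
   Context: For a set $X$, $\mathcal L(X)$ is the space of complex-valued functions on $X$. A reproducing kernel Hilbert space (RKHS) on $X$ is a vector subspace $\mathcal H\subset\mathcal L(X)$ with an inner product (linear in the first argument) making it a Hilbert space on which every point evaluation is continuous; $k_x\in\mathcal H$ is the kernel section with $f(x)=\langle f,k_x\rangle$, and $k(x,y)=\langle k_y,k_x\rangle$ is the kernel. $\mathcal H(k)$ denotes the unique RKHS with positive definite kernel $k$. An RKHS $\mathcal H$ is an RKHA if $k_x\mapsto k_x\otimes k_x$ ($x\in X$) extends to a bounded linear operator $\Delta\colon\mathcal H\to\mathcal H\otimes\mathcal H$ (Hilbert space tensor product); equivalently, pointwise multiplication extends to a bounded operator $\mathcal H\otimes\mathcal H\to\mathcal H$. An RKHA $\mathcal H$ is unital if $1\in\mathcal H$.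 Constructions (with $k_i$ the kernel of $\mathcal H_i$): (i) $\mathcal H_1\otimes\mathcal H_2\subset\mathcal L(X_1\times X_2)$ is the RKHS with kernel $k_1(x_1,y_1)k_2(x_2,y_2)$. (ii) $\mathcal H_1\oplus\mathcal H_2\subset\mathcal L(X_1\sqcup X_2)$ is the RKHS whose kernel is $k_i(x,y)$ if $x,y\in X_i$ and $0$ otherwise. (iii) Pullback along $\phi\colon S\to X$: $\mathcal H(k\circ\phi)=\{f\circ\phi: f\in\mathcal H(k)\}\subset\mathcal L(S)$, with kernel $(k\circ\phi)(s,t)=k(\phi(s),\phi(t))$. (iv) Pushout along $\phi\colon X\to S$: let $\tilde{\mathcal H}=\{f\in\mathcal H(k): f(x_1)=f(x_2)\text{ whenever }\phi(x_1)=\phi(x_2)\}$, a closed subspace, with kernel sections $\tilde k_x=P_{\tilde{\mathcal H}}(k_x)$ ($P_{\tilde{\mathcal H}}$ the orthogonal projection); set $k_\phi(s,t)=\tilde k(x,y)$ for any $x\in\phi^{-1}(s)$, $y\in\phi^{-1}(t)$, and $k_\phi(s,t)=0$ if $\phi^{-1}(s)$ or $\phi^{-1}(t)$ is empty. The pushout is $\mathcal H(k_\phi)\subset\mathcal L(S)$.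
   Formalization: Closure of unital RKHAs under pushout fails if φ: X→S is not surjective (every f in H(k_φ) vanishes off φ(X)); the formal statement gives 1 in H(k_φ) for surjective φ and, for arbitrary φ, that the indicator function of φ(X) lies in H(k_φ). *)

(* Defs.v *)
From HB Require Import structures.
From mathcomp Require Import all_boot all_order all_algebra.
From mathcomp Require Import sesquilinear complex.
From mathcomp Require Import boolp classical_sets functions reals.
From mathcomp Require Import topology normedtype.

Set Implicit Arguments.
Unset Strict Implicit.
Unset Printing Implicit Defensive.

Import Order.TTheory GRing.Theory Num.Theory numFieldNormedType.Exports.

Local Open Scope classical_set_scope.
Local Open Scope complex_scope.
Local Open Scope ring_scope.

Section Hilbert.
Variable R : realType.

(* [{dot U for Num.conj}] is linear in the first argument and conjugate-linear
   in the second, so [dot f f] is a nonnegative real of [R[i]]. *)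
Definition hnorm (U : lmodType R[i]) (dot : {dot U for Num.conj}) (f : U) : R :=
  Num.sqrt (complex.Re (dot f f)).

Definition hcomplete (U : lmodType R[i]) (dot : {dot U for Num.conj}) : Prop :=
  forall u : nat -> U,
    (forall e : R, 0 < e ->
       \forall m & n \near \oo, hnorm dot (u m - u n) < e) ->
    exists l : U, hnorm dot (u n - l) @[n --> \oo] --> (0 : R).

Definition bounded_linear (U V : lmodType R[i])
    (dotU : {dot U for Num.conj}) (dotV : {dot V for Num.conj})
    (L : {linear U -> V}) : Prop :=
  exists c : R, forall f : U, hnorm dotV (L f) <= c * hnorm dotU f.

(* [T], with elementary tensors [tau f g], is a Hilbert space tensor product
   of [U] and [V]. Scalars are absorbed by [tau], so sums of elementary tensors
   are the whole algebraic tensor product. *)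
Definition hilbert_tensor (U V T : lmodType R[i])
    (dotU : {dot U for Num.conj}) (dotV : {dot V for Num.conj})
    (dotT : {dot T for Num.conj}) (tau : {bilinear U -> V -> T}) : Prop :=
  [/\ hcomplete dotT,
      (forall f f' g g', dotT (tau f g) (tau f' g') = dotU f f' * dotV g g') &
      (forall (t : T) (e : R), 0 < e -> exists s : seq (U * V),
         hnorm dotT (t - \sum_(p <- s) tau p.1 p.2) < e)].

Definition eval_continuous (X : Type) (P : {pred X -> R[i]})
    (U : subLmodType P) (dot : {dot U for Num.conj}) (x : X) : Prop :=
  forall (f : U) (e : R), 0 < e ->
    exists2 d : R, 0 < d &
      forall g : U, hnorm dot (g - f) < d -> `|val g x - val f x| < e%:C.

(* Orthogonal projection onto [M]; the value is [0] if there is none, which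
   does not occur for a closed subspace [M] of a Hilbert space. *)
Definition hproj (U : lmodType R[i]) (dot : {dot U for Num.conj})
    (M : set U) (f : U) : U :=
  xget 0 [set g | M g /\ forall h, M h -> dot (f - g) h = 0].

End Hilbert.

Record rkhs (R : realType) (X : Type) := RKHS {
  rkhs_pred : {pred X -> R[i]};
  rkhs_sort :> subLmodType rkhs_pred;
  rkhs_dot : {dot rkhs_sort for Num.conj};
  rkhs_complete : hcomplete rkhs_dot;
  rkhs_eval : forall x, eval_continuous rkhs_dot x
}.

Section RKHS.
Variable R : realType.

(* The section exists and is unique by the Riesz representation theorem. *)
Definition ksec (X : Type) (H : rkhs R X) (x : X) : H :=
  xget 0 [set g : H | forall f : H, val f x = rkhs_dot H f g].

Definition kernel (X : Type) (H : rkhs R X) (x y : X) : R[i] :=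
  rkhs_dot H (ksec H y) (ksec H x).

Definition rkha (X : Type) (H : rkhs R X) : Prop :=
  exists (T : lmodType R[i]) (dotT : {dot T for Num.conj})
         (tau : {bilinear H -> H -> T}) (Delta : {linear H -> T}),
    [/\ hilbert_tensor (rkhs_dot H) (rkhs_dot H) dotT tau,
        bounded_linear (rkhs_dot H) dotT Delta &
        forall x, Delta (ksec H x) = tau (ksec H x) (ksec H x)].

Definition unital (X : Type) (H : rkhs R X) : Prop :=
  (fun=> 1) \in rkhs_pred H.

(* "H(K) exists and satisfies Q": the RKHS with a given kernel is unique as a
   subspace of [X -> R[i]] with inner product, but not as a term of [rkhs]. *)
Definition holds_for_kernel (X : Type) (K : X -> X -> R[i])
    (Q : rkhs R X -> Prop) : Prop :=
  (exists H : rkhs R X, kernel H = K) /\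
  (forall H : rkhs R X, kernel H = K -> Q H).

Definition tensor_kernel (X1 X2 : Type) (k1 : X1 -> X1 -> R[i])
    (k2 : X2 -> X2 -> R[i]) (x y : X1 * X2) : R[i] :=
  k1 x.1 y.1 * k2 x.2 y.2.

Definition sum_kernel (X1 X2 : Type) (k1 : X1 -> X1 -> R[i])
    (k2 : X2 -> X2 -> R[i]) (x y : X1 + X2) : R[i] :=
  match x, y with
  | inl x1, inl y1 => k1 x1 y1
  | inr x2, inr y2 => k2 x2 y2
  | _, _ => 0
  end.

Definition pullback_kernel (S X : Type) (phi : S -> X) (k : X -> X -> R[i])
    (s t : S) : R[i] := k (phi s) (phi t).

Section Pushout.
Variables (X S : Type) (H : rkhs R X) (phi : X -> S).

Definition fiber_constant : set H :=
  [set f | forall x1 x2, phi x1 = phi x2 -> val f x1 = val f x2].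

Definition fiber_ksec (x : X) : H :=
  hproj (rkhs_dot H) fiber_constant (ksec H x).

(* [cid] picks preimages of [s] and [t]; the value does not depend on them. *)
Definition pushout_kernel (s t : S) : R[i] :=
  match pselect (exists x, phi x = s), pselect (exists y, phi y = t) with
  | left hs, left ht =>
      rkhs_dot H (fiber_ksec (projT1 (cid ht))) (fiber_ksec (projT1 (cid hs)))
  | _, _ => 0
  end.

End Pushout.

End RKHS.

(* Main.v *)
(* Everything is read off kernels. An RKHS with kernel [k] is an RKHA iff
   [c k - k^2] is positive definite for some [c >= 0], and a function [F] lies in
   it iff [c k - F F^*] is. With the Schur product theorem these conditions pass
   to tensor products, direct sums and pullbacks, and Moore-Aronszajn provides
   the spaces. For the pushout, the projected sections [pk] are tested against
   the adjoint of [Delta]: pointwise products of fiber-constant functions are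
   fiber-constant, so projecting loses nothing. *)
Require Import Defs.
From HB Require Import structures.
From mathcomp Require Import all_boot all_order all_algebra.
From mathcomp Require Import sesquilinear complex.
From mathcomp Require Import boolp classical_sets functions reals.
From mathcomp Require Import topology normedtype.
From mathcomp Require Import ring lra.
Set Implicit Arguments.
Unset Strict Implicit.
Unset Printing Implicit Defensive.

Import Order.TTheory GRing.Theory Num.Theory numFieldNormedType.Exports.

Local Open Scope classical_set_scope.
Local Open Scope complex_scope.
Local Open Scope ring_scope.

(** * Squared modulus and limits of complex sequences *)

(** A result space is known only through its kernel, so the RKHA property must be readable there. It
    is, because the pointwise square of [k] is the Gram kernel of the vectors [tau k_x k_x]:
    positive definiteness of [c k - k^2] bounds the squared norm of [Delta] by [c] on the span of
    the sections. Products of such inequalities telescope: [a b - a' b' = (a - a') b + a' (b - b')].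
    The pushout escapes this scheme, since projecting sections does not commute with squaring the
    kernel; there [Delta] itself is used. Kernel sections, projections, interpolation and density
    all come from the one minimization in [riesz_graph]. *)

Section Complex.
Variable R : realType.
Implicit Types (z w l : R[i]) (u v : nat -> R[i]).

(** Squared moduli, and later squared norms, turn estimates into polynomial inequalities over [R].
    The triangle inequality then costs a factor 2 ([sqnD_le]), the origin of most numerical
    constants below. *)
Definition sqn z : R := complex.Re z ^+ 2 + complex.Im z ^+ 2.

Lemma sqn_ge0 z : 0 <= sqn z.
Proof. by rewrite addr_ge0 ?sqr_ge0. Qed.

Lemma sqn0 : sqn 0 = 0.
Proof. by rewrite /sqn /= expr0n addr0. Qed.

Lemma sqn1 : sqn 1 = 1.
Proof. by rewrite /sqn /= expr0n addr0 expr1n. Qed.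

Lemma sqnM z w : sqn (z * w) = sqn z * sqn w.
Proof. by case: z w => [a b] [c d]; rewrite /sqn /=; ring. Qed.

Lemma sqn_conj z : sqn z^* = sqn z.
Proof. by case: z => a b; rewrite /sqn /= sqrrN. Qed.

Lemma sqnN z : sqn (- z) = sqn z.
Proof. by case: z => a b; rewrite /sqn /= !sqrrN. Qed.

Lemma sqnB z w : sqn (z - w) = sqn (w - z).
Proof. by rewrite -opprB sqnN. Qed.

Lemma sqnD_le z w : sqn (z + w) <= 2 * sqn z + 2 * sqn w.
Proof.
case: z w => [a b] [c d]; rewrite /sqn /=.
by have := sqr_ge0 (a - c); have := sqr_ge0 (b - d); nra.
Qed.

Lemma sqn_eq0 z : sqn z <= 0 -> z = 0.
Proof.
case: z => a b /= h; have a0 : a = 0 by rewrite /sqn /= in h; nra.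
by have b0 : b = 0; [rewrite /sqn /= in h; nra | rewrite a0 b0].
Qed.

Lemma conjCreal (a : R) : (a%:C)^* = a%:C.
Proof. exact: conjc_real. Qed.

Lemma norm_ltC z (e : R) : 0 < e -> (`|z| < e%:C) = (sqn z < e ^+ 2).
Proof.
move=> e0; rewrite normc_def ltcR -[e in LHS]gtr0_norm// -sqrtr_sqr.
by rewrite ltr_sqrt// exprn_gt0.
Qed.

Lemma mul_conjE z : z * z^* = (sqn z)%:C.
Proof. by rewrite -normCK -add_Re2_Im2. Qed.

Lemma sqnC (a : R) : sqn a%:C = a ^+ 2.
Proof. by rewrite /sqn /= expr0n addr0. Qed.

Lemma sqnE z : sqn z = complex.Re (z * z^*).
Proof. by rewrite mul_conjE. Qed.

Lemma Re_le_sqn z : complex.Re z ^+ 2 <= sqn z.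
Proof. by rewrite lerDl sqr_ge0. Qed.

Lemma cReD z w : complex.Re (z + w) = complex.Re z + complex.Re w.
Proof. by case: z w => [a b] [c d]. Qed.

Lemma cReN z : complex.Re (- z) = - complex.Re z.
Proof. by case: z. Qed.

Lemma cRe_conj z : complex.Re z^* = complex.Re z.
Proof. by case: z. Qed.

Lemma cRe_realM (a : R) z : complex.Re (a%:C * z) = a * complex.Re z.
Proof. by case: z => b c /=; rewrite mul0r subr0. Qed.

Lemma ge0_ReC z : 0 <= z -> z = (complex.Re z)%:C.
Proof. by case: z => a b; rewrite lecE /= => /andP[/eqP-> _]. Qed.

Lemma cRe_ge0 z : 0 <= z -> 0 <= complex.Re z.
Proof. by rewrite lecE => /andP[]. Qed.

(* The discriminant argument behind the Cauchy-Schwarz inequality: test the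
   hypothesis on the multiples [t = - s w^*] with [s] real. *)
Lemma discriminant_le (a b : R) w : 0 <= b ->
  (forall t : R[i], 0 <= a + 2 * complex.Re (t * w) + sqn t * b) ->
  sqn w <= a * b.
Proof.
move=> b0 h.
have q0 := sqn_ge0 w.
have hs (s : R) : 0 <= a - 2 * s * sqn w + s ^+ 2 * sqn w * b.
  have := h (- s%:C * w^*); rewrite !sqnM sqnN sqnC sqn_conj.
  have -> : - s%:C * w^* * w = - (s%:C * (w * w^*)) by ring.
  by rewrite mul_conjE cReN -rmorphM /= mulrN -!mulrA.
have [bE|b_gt0] := eqVneq b 0.
  rewrite bE mulr0 leNgt; apply/negP => q_gt0.
  (* Without a quadratic term the bound is linear in [s]; this [s] brings it down to -1. *)
  have := hs ((a + 1) / (2 * sqn w)); rewrite bE mulr0 addr0.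
  have -> : 2 * ((a + 1) / (2 * sqn w)) * sqn w = a + 1 by field; lra.
  lra.
have {}b_gt0 : 0 < b by rewrite lt_def b_gt0.
have := hs b^-1.
have -> : a - 2 * b^-1 * sqn w + b^-1 ^+ 2 * sqn w * b = a - sqn w / b.
  by field; lra.
by rewrite subr_ge0 ler_pdivrMr.
Qed.

Lemma natSinv_lt (e : R) : 0 < e ->
  exists N, forall n, (N <= n)%N -> n.+1%:R^-1 < e.
Proof.
move=> e0; exists (Num.truncn e^-1) => n Nn.
rewrite invf_plt ?posrE// (lt_le_trans (truncnS_gt _))//.
by rewrite ler_nat.
Qed.

Definition tends u l :=
  forall e : R, 0 < e -> exists N, forall n, (N <= n)%N -> sqn (u n - l) <= e.

Lemma tends_unique u l l' : tends u l -> tends u l' -> l = l'.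
Proof.
move=> ul ul'; apply/eqP; rewrite -subr_eq0; apply/eqP/sqn_eq0.
rewrite leNgt; apply/negP => d0.
have e0 : 0 < sqn (l - l') / 8 by lra.
have [[N hN] [M hM]] := (ul _ e0, ul' _ e0).
have := hN (maxn N M) (leq_maxl _ _); have := hM (maxn N M) (leq_maxr _ _).
have := sqnD_le (l - u (maxn N M)) (u (maxn N M) - l').
rewrite addrA subrK (sqnB l (u _)); lra.
Qed.

Lemma tends_cst l : tends (fun=> l) l.
Proof. by move=> e e0; exists 0%N => n _; rewrite subrr sqn0 ltW. Qed.

Lemma tendsD u v l l' :
  tends u l -> tends v l' -> tends (fun n => u n + v n) (l + l').
Proof.
move=> ul vl e e0.
have e4 : 0 < e / 4 by lra.
have [[N hN] [M hM]] := (ul _ e4, vl _ e4).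
exists (maxn N M) => n; rewrite geq_max => /andP[/hN h1 /hM h2].
by have := sqnD_le (u n - l) (v n - l'); rewrite addrACA -opprD; lra.
Qed.

Lemma tendsZ u l z : tends u l -> tends (fun n => z * u n) (z * l).
Proof.
move=> ul e e0; have c0 := sqn_ge0 z.
have e1 : 0 < e / (sqn z + 1) by rewrite divr_gt0//; lra.
have [N hN] := ul _ e1; exists N => n /hN h.
rewrite -mulrBr sqnM (le_trans (ler_wpM2l c0 h))//.
rewrite mulrCA ler_piMr ?(ltW e0)// ler_pdivrMr; lra.
Qed.

Lemma tends_conj u l : tends u l -> tends (fun n => (u n)^*) l^*.
Proof.
move=> ul e /ul[N hN]; exists N => n /hN.
by rewrite -rmorphB /= sqn_conj.
Qed.

Lemma tends_Re_le u l (c : R) :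
  (forall e : R, 0 < e -> exists N, forall n, (N <= n)%N -> complex.Re (u n) <= c + e) ->
  tends u l -> complex.Re l <= c.
Proof.
move=> uc ul; rewrite leNgt; apply/negP => cl.
have d0 : 0 < (complex.Re l - c) / 2 by lra.
have [N hN] := uc _ d0.
have d1 : 0 < ((complex.Re l - c) / 4) ^+ 2 by rewrite exprn_gt0//; lra.
have [M hM] := ul _ d1.
have := hN (maxn N M) (leq_maxl _ _); have := hM (maxn N M) (leq_maxr _ _).
have := Re_le_sqn (u (maxn N M) - l); rewrite cReD cReN.
set r := complex.Re (u _); nra.
Qed.

(** Nonnegative elements of [R[i]] are real, so by uniqueness the limit equals its own conjugate;
    then only its real part is left to compare. *)
Lemma tends_ge0 u l : (forall n, 0 <= u n) -> tends u l -> 0 <= l.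
Proof.
move=> u0 ul.
have ul' : tends u l^*.
  have := tends_conj ul; rewrite (_ : (fun n => _) = u)//.
  by apply/funext => n; rewrite geC0_conj.
have := tends_unique ul ul'; case: l ul {ul'} => a b ul [] b0.
have {}b0 : b = 0 by lra.
rewrite lecE /= b0 eqxx /= -oppr_le0.
have : complex.Re (-1 * (a +i* b)) <= 0; last by rewrite /=; lra.
apply: (tends_Re_le _ (tendsZ (-1) ul)) => e e0; exists 0%N => n _.
by rewrite mulN1r cReN; have := cRe_ge0 (u0 n); lra.
Qed.

Lemma real_cauchy_cvg (x : nat -> R) :
  (forall e : R, 0 < e -> exists N, forall m n, (N <= m)%N -> (N <= n)%N ->
     (x m - x n) ^+ 2 <= e) ->
  exists l : R, forall e : R, 0 < e -> exists N, forall n, (N <= n)%N ->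
     (x n - l) ^+ 2 <= e.
Proof.
move=> cx; have /cvg_ex[l xl] : cvg (x @ \oo).
  apply: cauchy_cvg; apply: cauchy_exP => e e0.
  have [|N hN] := cx ((e / 2) ^+ 2); first by rewrite exprn_gt0// divr_gt0.
  exists (x N); exists N => // n /= Nn; rewrite -ball_normE /=.
  have := hN N n (leqnn _) Nn.
  by rewrite -ler_sqrt ?sqr_ge0// !sqrtr_sqr (gtr0_norm (_ : 0 < e / 2))//; lra.
exists l => e e0; have s0 : 0 < Num.sqrt e by rewrite sqrtr_gt0.
have /cvgrPdist_lt/(_ _ s0)[N _ hN] := xl.
exists N => n /hN; rewrite distrC => h.
by rewrite -[leRHS](sqr_sqrtr (ltW e0)) -real_normK ?num_real// lerXn2r ?nnegrE// ltW.
Qed.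

Lemma cauchy_tends u :
  (forall e : R, 0 < e -> exists N, forall m n, (N <= m)%N -> (N <= n)%N ->
     sqn (u m - u n) <= e) ->
  exists l, tends u l.
Proof.
move=> cu.
have [e0|a ha] := @real_cauchy_cvg (fun n => complex.Re (u n)).
  move=> /cu[N hN]; exists N => m n mN nN; apply: le_trans (hN m n mN nN).
  by have := Re_le_sqn (u m - u n); rewrite cReD cReN.
have [e0|b hb] := @real_cauchy_cvg (fun n => complex.Im (u n)).
  move=> /cu[N hN]; exists N => m n mN nN; apply: le_trans (hN m n mN nN).
  by rewrite /sqn /=; case: (u m) (u n) => [? ?] [? ?] /=; rewrite lerDr sqr_ge0.
exists (a +i* b) => e e0; have e2 : 0 < e / 2 by lra.
have [[N hN] [M hM]] := (ha _ e2, hb _ e2).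
exists (maxn N M) => n; rewrite geq_max => /andP[/hN h1 /hM h2].
by move: h1 h2; rewrite /sqn /=; case: (u n) => [? ?] /=; lra.
Qed.

End Complex.

(** * Inner product spaces and the Riesz representation *)

Section Dot.
Variables (R : realType) (U : lmodType R[i]) (dot : {dot U for Num.conj}).
Implicit Types (u v w : U) (a b : R[i]).

Definition nsq u : R := complex.Re (dot u u).

Lemma dot_sym u v : dot u v = (dot v u)^*.
Proof. by rewrite (hermC dot) expr0 mul1r. Qed.

Lemma dotDl u v w : dot (u + v) w = dot u w + dot v w.
Proof. exact: linearDl. Qed.

Lemma dotDr u v w : dot u (v + w) = dot u v + dot u w.
Proof. exact: linearDr. Qed.

Lemma dotBl u v w : dot (u - v) w = dot u w - dot v w.
Proof. exact: linearBl. Qed.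

Lemma dotBr u v w : dot u (v - w) = dot u v - dot u w.
Proof. exact: linearBr. Qed.

Lemma dotNr u v : dot u (- v) = - dot u v.
Proof. exact: linearNr. Qed.

Lemma dot0l u : dot 0 u = 0.
Proof. exact: linear0l. Qed.

Lemma dotZl a u v : dot (a *: u) v = a * dot u v.
Proof. exact: linearZl_LR. Qed.

Lemma dotZr a u v : dot u (a *: v) = a^* * dot u v.
Proof. exact: linearZr_LR. Qed.

Lemma dot_suml (I : Type) (r : seq I) (F : I -> U) w :
  dot (\sum_(i <- r) F i) w = \sum_(i <- r) dot (F i) w.
Proof. exact: linear_sumlz. Qed.

Lemma dotuu_ge0 u : 0 <= dot u u.
Proof.
have [->|u0] := eqVneq u 0; first by rewrite dot0l.
exact/ltW/neq0_dnorm_gt0.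
Qed.

Lemma dotuuE u : dot u u = (nsq u)%:C.
Proof. exact/ge0_ReC/dotuu_ge0. Qed.

Lemma nsq_ge0 u : 0 <= nsq u.
Proof. exact/cRe_ge0/dotuu_ge0. Qed.

Lemma nsq0 : nsq 0 = 0.
Proof. by rewrite /nsq dot0l. Qed.

Lemma nsq_eq0 u : nsq u <= 0 -> u = 0.
Proof.
move=> h; apply/eqP; apply/negP => /negP /(neq0_dnorm_gt0 (s := dot)).
by rewrite dotuuE ltcR ltNge h.
Qed.

Lemma nsqZ a u : nsq (a *: u) = sqn a * nsq u.
Proof.
rewrite /nsq dotZl dotZr mulrA mul_conjE dotuuE -rmorphM //=.
Qed.

Lemma nsqN u : nsq (- u) = nsq u.
Proof. by rewrite -scaleN1r nsqZ sqnN sqn1 mul1r. Qed.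

Lemma nsqB_sym u v : nsq (u - v) = nsq (v - u).
Proof. by rewrite -opprB nsqN. Qed.

Lemma nsqD u v : nsq (u + v) = nsq u + nsq v + 2 * complex.Re (dot u v).
Proof.
rewrite /nsq dotDl !dotDr !cReD (dot_sym v u) cRe_conj; ring.
Qed.

Lemma nsqB u v : nsq (u - v) = nsq u + nsq v - 2 * complex.Re (dot u v).
Proof. by rewrite nsqD nsqN dotNr cReN mulrN. Qed.

Lemma dot_CS u v : sqn (dot u v) <= nsq u * nsq v.
Proof.
rewrite mulrC -[sqn _]sqn_conj -dot_sym.
apply: discriminant_le => [|t]; first exact: nsq_ge0.
by have := nsq_ge0 (v + t^* *: u); rewrite nsqD nsqZ sqn_conj dotZr conjCK; lra.
Qed.

Lemma dot_inj u v : (forall w, dot w u = dot w v) -> u = v.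
Proof.
move=> h; apply/eqP; rewrite -subr_eq0; apply/eqP/nsq_eq0.
by rewrite /nsq dotBr h subrr.
Qed.

Lemma hnorm_lt u (e : R) : 0 < e -> (hnorm dot u < e) = (nsq u < e ^+ 2).
Proof.
move=> e0; rewrite /hnorm -/(nsq u) -[e in LHS]gtr0_norm// -sqrtr_sqr.
by rewrite ltr_sqrt// exprn_gt0.
Qed.

Lemma sqr_hnorm u : hnorm dot u ^+ 2 = nsq u.
Proof. by rewrite sqr_sqrtr ?nsq_ge0. Qed.

Definition nsq_tends (x : nat -> U) u :=
  forall e : R, 0 < e -> exists N, forall n, (N <= n)%N -> nsq (x n - u) < e.

Definition nsq_cauchy (x : nat -> U) :=
  forall e : R, 0 < e ->
    exists N, forall m n, (N <= m)%N -> (N <= n)%N -> nsq (x m - x n) < e.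

Lemma hcompleteP :
  hcomplete dot <-> forall x, nsq_cauchy x -> exists u, nsq_tends x u.
Proof.
split=> h x cx.
  have [|u xu] := h x.
    move=> e e0; have [N hN] := cx (e ^+ 2) (exprn_gt0 2 e0).
    exists ([set n | (N <= n)%N], [set n | (N <= n)%N]).
      by split; exists N.
    by case=> m n /= [mN nN]; rewrite hnorm_lt// hN.
  exists u => e e0; have s0 : 0 < Num.sqrt e by rewrite sqrtr_gt0.
  have /cvgrPdist_lt/(_ _ s0)[N _ hN] := xu.
  exists N => n /hN; rewrite sub0r normrN ger0_norm ?sqrtr_ge0//.
  by rewrite hnorm_lt// sqr_sqrtr ?ltW.
have [|u xu] := h x.
  move=> e e0; have s0 : 0 < Num.sqrt e by rewrite sqrtr_gt0.
  have [[A B] [[N1 _ h1] [N2 _ h2]] hAB] := cx _ s0.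
  exists (maxn N1 N2) => m n; rewrite !geq_max => /andP[m1 m2] /andP[n1 n2].
  have := hAB (m, n) (conj (h1 _ m1) (h2 _ n2)).
  by rewrite /= hnorm_lt// sqr_sqrtr ?ltW.
exists u; apply/cvgrPdist_lt => e e0.
have [N hN] := xu (e ^+ 2) (exprn_gt0 2 e0).
exists N => // n /= /hN; rewrite sub0r normrN ger0_norm ?sqrtr_ge0//.
by rewrite hnorm_lt.
Qed.

Lemma nsq_le_small u (c : R) :
  (forall e : R, 0 < e -> nsq u <= c + e) -> nsq u <= c.
Proof. by move=> h; apply/ler_addgt0Pr => e /h. Qed.

Section Riesz.
Hypothesis complete : hcomplete dot.

(* [G] is the graph of a functional on a not necessarily closed subspace; the
   representing vector is the limit of a minimizing sequence for
   [nsq u - 2 Re a] on [G]. *)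
Lemma riesz_graph (G : U -> R[i] -> Prop) (c : R) :
  0 <= c -> G 0 0 ->
  (forall t u v a b, G u a -> G v b -> G (t *: u + v) (t * a + b)) ->
  (forall u a, G u a -> sqn a <= c * nsq u) ->
  exists g, [/\ forall u a, G u a -> a = dot u g, nsq g <= c &
    forall e : R, 0 < e -> exists u a, G u a /\ nsq (u - g) < e].
Proof.
move=> c0 G0 Glin Gc.
pose Phi u a := nsq u - 2 * complex.Re a.
(* With [q = nsq u], [(Re a)^2 <= c q <= ((q + c) / 2)^2], so [2 Re a <= q + c]. *)
have Phi_ge u a : G u a -> - c <= Phi u a.
  move=> /Gc h; have := Re_le_sqn a; have := nsq_ge0 u; rewrite /Phi.
  move: h; set r := complex.Re a; set q := nsq u => h q0 h'.
  rewrite -subr_ge0 opprK leNgt; apply/negP => hlt.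
  have := sqr_ge0 (q - c); have : 0 < (2 * r - (q + c)) * (2 * r + (q + c)).
    by apply: mulr_gt0; lra.
  by lra.
pose S := [set r | exists u a, G u a /\ r = Phi u a].
have S0 : has_inf S.
  split; first by exists (Phi 0 0), 0, 0.
  by exists (- c) => _ [u [a [/Phi_ge h ->]]].
pose d := inf S.
have d_le u a : G u a -> d <= Phi u a.
  by move=> h; apply: ge_inf; [case: S0|exists u, a].
have ex_min n : exists p : U * R[i], G p.1 p.2 /\ Phi p.1 p.2 < d + n.+1%:R^-1.
  have [|_ [u [a [Gua ->]]] h] := @inf_adherent _ S n.+1%:R^-1 _ S0.
    by rewrite invr_gt0.
  by exists (u, a).
have [x xP] := choice ex_min.
have xG n : G (x n).1 (x n).2 by case: (xP n).
have cx : nsq_cauchy (fun n => (x n).1).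
  move=> e e0; have [N hN] : exists N, forall n, (N <= n)%N -> n.+1%:R^-1 < e / 4.
    by apply: natSinv_lt; lra.
  exists N => m n /hN mN /hN nN.
  have [[Gm Pm] [Gn Pn]] := (xP m, xP n).
  (* Parallelogram law: [Phi] is at least [d] at the midpoint, so the two vectors differ in squared
     norm by at most [2 (1/(m+1) + 1/(n+1))]. *)
  have := d_le _ _ (Glin 2^-1 _ _ _ _ (Glin 1 _ _ _ _ Gm Gn) G0).
  rewrite /Phi !addr0 !scale1r !mul1r nsqZ nsqB nsqD.
  have -> : (2^-1 : R[i]) = (2^-1 : R)%:C by rewrite fmorphV rmorph_nat.
  rewrite sqnC cRe_realM cReD.
  move: Pm Pn; rewrite /Phi; move: mN nN.
  set p := m.+1%:R^-1; set q := n.+1%:R^-1; lra.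
have [g xg] := (hcompleteP.1 complete) _ cx.
have gG : forall e : R, 0 < e -> exists u a, G u a /\ nsq (u - g) < e.
  move=> e /xg[N hN]; exists (x N).1, (x N).2; split; first exact: xG.
  exact: hN.
have repr u a : G u a -> a = dot u g.
  move=> Gua; apply/eqP; rewrite -subr_eq0; apply/eqP/sqn_eq0.
  (* Moving the near-minimizer by [t *: u] lowers [Phi] by at most [1/(n+1)]; the discriminant of
     this quadratic in [t] is the bound. *)
  have near n : sqn (dot u (x n).1 - a) <= n.+1%:R^-1 * nsq u.
    apply: discriminant_le => [|t]; first exact: nsq_ge0.
    have := d_le _ _ (Glin t _ _ _ _ Gua (xG n)); have [_] := xP n.
    rewrite /Phi nsqD nsqZ dotZl mulrBr !cReD !cReN.
    by move: (n.+1%:R^-1) => i; lra.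
  apply/ler_addgt0Pr => e e0; rewrite add0r.
  have k0 : 0 < 4 * (nsq u + 1) by have := nsq_ge0 u; lra.
  have e1 : 0 < e / (4 * (nsq u + 1)) by rewrite divr_gt0.
  have [[N hN] [M hM]] := (xg _ e1, natSinv_lt e1).
  have := sqnD_le (dot u (x (maxn N M)).1 - dot u g) (a - dot u (x (maxn N M)).1).
  have -> : dot u (x (maxn N M)).1 - dot u g + (a - dot u (x (maxn N M)).1)
    = a - dot u g by ring.
  have h1 := dot_CS u ((x (maxn N M)).1 - g).
  have := near (maxn N M); rewrite sqnB => h2.
  have /(ler_wpM2l (nsq_ge0 u)) h3 := ltW (hN (maxn N M) (leq_maxl _ _)).
  have /(ler_wpM2l (nsq_ge0 u)) h4 := ltW (hM (maxn N M) (leq_maxr _ _)).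
  have h5 : nsq u * (e / (4 * (nsq u + 1))) <= e / 4.
    rewrite mulrCA; apply: ler_wpM2l; first exact: ltW.
    by rewrite ler_pdivrMr//; lra.
  rewrite -dotBr; move: h1 h2 h3 h4 h5.
  by move: (_ / (4 * _)) ((maxn N M).+1%:R^-1) => r i; lra.
(* As [a = dot u g], [Phi u a] is [nsq (u - g) - nsq g]; it is at least [- c], while
   [nsq (u - g) < e]. *)
exists g; split => //; apply: nsq_le_small => e /gG[u [a [Gua h]]].
have := Phi_ge _ _ Gua; rewrite /Phi (repr _ _ Gua).
by move: h; rewrite nsqB; lra.
Qed.

End Riesz.
End Dot.

(** * Positive definite kernels *)

Section Kernel.
Variable R : realType.

Section WeightedPoints.
Variable X : Type.
Implicit Types (s t : seq (R[i] * X)) (f g : X -> R[i]) (K : X -> X -> R[i]).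

(* A list [s] of weighted points stands for the formal sum of the [p.1 *: k_p.2]:
   [sec K s] is that sum as a function, [pair s f] its inner product with [f],
   [qf K s t] the inner product of two such sums. *)
Definition pair s f : R[i] := \sum_(p <- s) p.1 * (f p.2)^*.
Definition sec K s : X -> R[i] := fun x => \sum_(p <- s) p.1 * K x p.2.
Definition qf K s t := pair s (sec K t).
Definition qn K s : R := complex.Re (qf K s s).
Definition scl (a : R[i]) s := [seq (a * p.1, p.2) | p <- s].

Lemma pair_cat s t f : pair (s ++ t) f = pair s f + pair t f.
Proof. exact: big_cat. Qed.

Lemma pair_cons p s f : pair (p :: s) f = p.1 * (f p.2)^* + pair s f.
Proof. exact: big_cons. Qed.

Lemma pair_scl a s f : pair (scl a s) f = a * pair s f.
Proof. by rewrite /pair big_map mulr_sumr; apply: eq_bigr => p _; rewrite mulrA. Qed.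

Lemma pair1 x f : pair [:: (1, x)] f = (f x)^*.
Proof. by rewrite /pair big_seq1 mul1r. Qed.

Lemma pairD s f g : pair s (f + g) = pair s f + pair s g.
Proof. by rewrite -big_split /=; apply: eq_bigr => p _; rewrite rmorphD mulrDr. Qed.

Lemma pairZ a s f : pair s (a *: f) = a^* * pair s f.
Proof. by rewrite mulr_sumr; apply: eq_bigr => p _; rewrite rmorphM mulrCA. Qed.

Lemma pairB s f g : pair s (f - g) = pair s f - pair s g.
Proof. by rewrite -scaleN1r pairD pairZ rmorphN1 mulN1r. Qed.

Lemma sec_cat K s t : sec K (s ++ t) = sec K s + sec K t.
Proof. by apply/funext => x; exact: big_cat. Qed.

Lemma sec_scl K a s : sec K (scl a s) = a *: sec K s.
Proof.
apply/funext => x; rewrite /sec /scl big_map /= [RHS]mulr_sumr.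
by apply: eq_bigr => p _; rewrite mulrA.
Qed.

Lemma sec1 K x : sec K [:: (1, x)] = K ^~ x.
Proof. by apply/funext => y; rewrite /sec big_seq1 mul1r. Qed.

Lemma qf_catl K s s' t : qf K (s ++ s') t = qf K s t + qf K s' t.
Proof. exact: pair_cat. Qed.

Lemma qf_catr K s t t' : qf K s (t ++ t') = qf K s t + qf K s t'.
Proof. by rewrite /qf sec_cat pairD. Qed.

Lemma qf_scll K a s t : qf K (scl a s) t = a * qf K s t.
Proof. exact: pair_scl. Qed.

Lemma qf_sclr K a s t : qf K s (scl a t) = a^* * qf K s t.
Proof. by rewrite /qf sec_scl pairZ. Qed.

Lemma qfE K s t :
  qf K s t = \sum_(p <- s) \sum_(q <- t) p.1 * q.1^* * (K p.2 q.2)^*.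
Proof.
apply: eq_bigr => p _; rewrite rmorph_sum mulr_sumr; apply: eq_bigr => q _.
by rewrite rmorphM mulrA.
Qed.

Lemma qf1 K x y : qf K [:: (1, x)] [:: (1, y)] = (K x y)^*.
Proof. by rewrite /qf pair1 sec1. Qed.

Definition herm K := forall x y, K x y = (K y x)^*.
Definition psd K := herm K /\ forall s, 0 <= qn K s.

Lemma qf_sym K s t : herm K -> qf K s t = (qf K t s)^*.
Proof.
move=> hK; rewrite !qfE rmorph_sum exchange_big; apply: eq_bigr => q _.
rewrite rmorph_sum; apply: eq_bigr => p _.
by rewrite !rmorphM /= !conjCK -hK [_^* * _]mulrC.
Qed.

Lemma qfE_qn K s : herm K -> qf K s s = (qn K s)%:C.
Proof.
move=> hK; rewrite /qn; have := qf_sym s s hK; case: (qf K s s) => a b [] h.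
by have -> : b = 0 by lra.
Qed.

Lemma qn_cat K s t : herm K ->
  qn K (s ++ t) = qn K s + qn K t + 2 * complex.Re (qf K s t).
Proof.
move=> hK; rewrite /qn qf_catl !qf_catr !cReD (qf_sym t s hK) cRe_conj; ring.
Qed.

Lemma qn_scl K a s : herm K -> qn K (scl a s) = sqn a * qn K s.
Proof.
by move=> hK; rewrite {1}/qn qf_scll qf_sclr mulrA mul_conjE qfE_qn// -rmorphM.
Qed.

Lemma qf_CS K s t : psd K -> sqn (qf K s t) <= qn K s * qn K t.
Proof.
move=> [hK K0]; rewrite mulrC -[sqn _]sqn_conj -qf_sym//.
apply: discriminant_le => [|a]; first exact: K0.
have := K0 (t ++ scl a^* s).
by rewrite qn_cat// qn_scl// sqn_conj qf_sclr conjCK; lra.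
Qed.

Lemma qfD K K' s t : qf (fun x y => K x y + K' x y) s t = qf K s t + qf K' s t.
Proof.
rewrite -pairD; congr pair; apply/funext => x; rewrite /sec.
by under eq_bigr do rewrite mulrDr; exact: big_split.
Qed.

Lemma qfZ K (c : R) s t : qf (fun x y => c%:C * K x y) s t = c%:C * qf K s t.
Proof.
rewrite -[c%:C in RHS]conjCreal -pairZ; congr pair; apply/funext => x.
by rewrite [RHS]mulr_sumr; apply: eq_bigr => p _; rewrite mulrCA.
Qed.

Lemma qf_rank1 f s t : qf (fun x y => f x * (f y)^*) s t = pair s f * (pair t f)^*.
Proof.
rewrite qfE /pair mulr_suml; apply: eq_bigr => p _.
rewrite rmorph_sum mulr_sumr; apply: eq_bigr => q _.
by rewrite !rmorphM /= conjCK; ring.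
Qed.

Lemma qn_rank1 f s : qn (fun x y => f x * (f y)^*) s = sqn (pair s f).
Proof. by rewrite /qn qf_rank1 -sqnE. Qed.

Lemma psdD K K' : psd K -> psd K' -> psd (fun x y => K x y + K' x y).
Proof.
move=> [hK K0] [hK' K0']; split=> [x y|s]; first by rewrite rmorphD /= -hK -hK'.
by rewrite /qn qfD cReD addr_ge0// ?K0// K0'.
Qed.

Lemma psdZ K (c : R) : 0 <= c -> psd K -> psd (fun x y => c%:C * K x y).
Proof.
move=> c0 [hK K0]; split=> [x y|s]; first by rewrite rmorphM /= -hK conjCreal.
by rewrite /qn qfZ cRe_realM mulr_ge0// K0.
Qed.

Lemma psd_rank1 f : psd (fun x y => f x * (f y)^*).
Proof.
by split=> [x y|s]; [rewrite rmorphM /= conjCK mulrC | rewrite qn_rank1 sqn_ge0].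
Qed.

(** Trades boundedness of [f] as a functional on formal sums for positive definiteness, which
    survives Schur products; used in both directions. *)
Lemma psd_sub_rank1 K f (c : R) : herm K ->
  psd (fun x y => c%:C * K x y - f x * (f y)^*) <->
  forall s, sqn (pair s f) <= c * qn K s.
Proof.
move=> hK.
have qnE s : qn (fun x y => c%:C * K x y - f x * (f y)^*) s =
    c * qn K s - sqn (pair s f).
  have -> : (fun x y => c%:C * K x y - f x * (f y)^*) =
      (fun x y => c%:C * K x y + (-1)%:C * (f x * (f y)^*)).
    by apply/funext => x; apply/funext => y; rewrite rmorphN1 mulN1r.
  by rewrite /qn qfD !qfZ cReD !cRe_realM -/(qn K s) -qn_rank1 mulN1r.
split=> [[_ h] s|h]; first by rewrite -subr_ge0 -qnE.
split=> [x y|s]; last by rewrite qnE subr_ge0.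
by rewrite rmorphB !rmorphM /= -hK conjCK conjCreal (mulrC (f x)).
Qed.

Lemma psd_diag0 K x y : psd K -> K y y = 0 -> K x y = 0.
Proof.
move=> pK Ky; apply: (inv_inj (@conjCK _)); rewrite conjC0 -qf1.
apply/sqn_eq0/(le_trans (qf_CS _ _ pK)).
by rewrite mulrC /qn qf1 Ky conjC0 /= mul0r.
Qed.

(* By induction on the points: split off from [K] the rank-one kernel through
   its first point, the Schur complement vanishes at that point. *)
Lemma qn_mul_ge0 K K' s :
  psd K -> psd K' -> 0 <= qn (fun x y => K x y * K' x y) s.
Proof.
move=> + pK'; elim: s K => [|[a z] s IH] K pK.
  by rewrite /qn /qf /pair big_nil.
have [hK K0] := pK.
pose k := complex.Re (K z z).
have kE : K z z = k%:C.
  have := hK z z; rewrite /k; case: (K z z) => b c [] h.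
  by have -> : c = 0 by lra.
have k0 : 0 <= k by have := K0 [:: (1, z)]; rewrite /qn qf1 kE.
pose g := K ^~ z.
(* Since [0^-1 = 0], [L] is [K] when [k = 0]; the column of [K] at [z] is then zero by
   Cauchy-Schwarz, so [L] vanishes at [z] in both cases. *)
pose L x y := K x y + (- k^-1)%:C * (g x * (g y)^*).
have pL : psd L.
  split=> [x y|t].
    by rewrite /L rmorphD !rmorphM /= -hK conjCK conjCreal (mulrC (g x)).
  rewrite /qn qfD qfZ cReD cRe_realM -!/(qn _ t) qn_rank1.
  have := qf_CS t [:: (1, z)] pK; rewrite {1}/qf sec1 -/g /qn qf1 kE /= mulNr subr_ge0.
  have [->|kn0] := eqVneq k 0; first by rewrite invr0 mul0r => _; exact: K0.
  by rewrite [k^-1 * _]mulrC ler_pdivrMr// lt_def kn0.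
have Lz x : L x z = 0.
  rewrite /L /g kE; have [k00|kn0] := eqVneq k 0.
    by rewrite (psd_diag0 x pK) ?kE ?k00// mul0r mulr0 addr0.
  rewrite conjCreal mulrCA -rmorphM mulNr mulVf//.
  by rewrite rmorphN1 mulrN1 subrr.
have Lz' x : L z x = 0 by rewrite (pL.1) Lz conjC0.
have -> : (fun x y => K x y * K' x y) = (fun x y => L x y * K' x y +
    k^-1%:C * (g x * (g y)^* * K' x y)).
  by apply/funext => x; apply/funext => y; rewrite /L rmorphN; ring.
rewrite /qn qfD qfZ cReD cRe_realM addr_ge0// ?mulr_ge0 ?invr_ge0//.
  have := IH _ pL; rewrite /qn !qfE big_cons [X in _ -> _ <= complex.Re (X + _)]big1.
    2: by move=> p _; rewrite Lz' mul0r conjC0 mulr0.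
  rewrite add0r; congr (_ <= complex.Re _); apply: eq_bigr => p _.
  by rewrite big_cons Lz mul0r conjC0 mulr0 add0r.
(* Multiplying [K'] by a rank-one kernel only rescales the weights in its form. *)
have := pK'.2 [seq (p.1 * (g p.2)^*, p.2) | p <- (a, z) :: s].
rewrite /qn !qfE big_map; congr (_ <= complex.Re _); apply: eq_bigr => p _.
rewrite big_map; apply: eq_bigr => q _ /=.
by rewrite !rmorphM /= !conjCK; ring.
Qed.

Lemma psdM K K' : psd K -> psd K' -> psd (fun x y => K x y * K' x y).
Proof.
move=> pK pK'; split=> [x y|s]; last exact: qn_mul_ge0.
by rewrite rmorphM /= -pK.1 -pK'.1.
Qed.

End WeightedPoints.

(** A partial map unites composition with extension by zero: total maps give pullbacks, partial
    inverses of the injections give direct sums, a choice of preimages gives pushouts. *)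
Definition extension (X S : Type) (phi : S -> option X) (K : X -> X -> R[i])
    (s t : S) : R[i] :=
  match phi s, phi t with Some x, Some y => K x y | _, _ => 0 end.

Lemma psd_extension (X S : Type) (phi : S -> option X) (K : X -> X -> R[i]) :
  psd K -> psd (extension phi K).
Proof.
move=> pK; split=> [x y|s].
  by rewrite /extension; case: (phi x) (phi y) => [?|] [?|]; rewrite ?conjC0// -pK.1.
pose r := pmap (fun p : R[i] * S => omap (fun x => (p.1, x)) (phi p.2)) s.
have sumE (F : R[i] * X -> R[i]) : \sum_(p <- r) F p =
    \sum_(p <- s) (if phi p.2 is Some x then F (p.1, x) else 0).
  rewrite /r; elim: s {r} => [|[a z] s IH] /=; first by rewrite !big_nil.
  by rewrite big_cons /=; case: (phi z) => [x|] /=; rewrite ?big_cons ?add0r IH.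
have := pK.2 r; rewrite /qn !qfE sumE; congr (_ <= complex.Re _).
apply: eq_bigr => p _; rewrite /extension; case: (phi p.2) => [x|].
  rewrite sumE; apply: eq_bigr => q _ /=.
  by case: (phi q.2) => [y|]//; rewrite conjC0 mulr0.
by rewrite big1// => q _; rewrite conjC0 mulr0.
Qed.

Lemma psd_pullback (X S : Type) (phi : S -> X) (K : X -> X -> R[i]) :
  psd K -> psd (pullback_kernel phi K).
Proof. exact: (@psd_extension X S (Some \o phi)). Qed.

Lemma psd_tensor (X1 X2 : Type) (K1 : X1 -> X1 -> R[i]) (K2 : X2 -> X2 -> R[i]) :
  psd K1 -> psd K2 -> psd (tensor_kernel K1 K2).
Proof.
move=> p1 p2; exact: (psdM (psd_pullback fst p1) (psd_pullback snd p2)).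
Qed.

End Kernel.

(** * The Moore-Aronszajn theorem *)

Section MooreAronszajn.
Variables (R : realType) (X : Type) (K : X -> X -> R[i]).
Hypothesis pK : psd K.
Let hK : herm K := proj1 pK.
Implicit Types (s : seq (R[i] * X)) (u v w : nat -> seq (R[i] * X)).
Implicit Types (f g h : X -> R[i]) (a : R[i]) (c e : R).

(* The squared norm of [f] as a functional on the formal sums is at most [c]. *)
Definition dle f c := forall s, sqn (pair s f) <= c * qn K s.

Lemma dleD f g c c' : dle f c -> dle g c' -> dle (f + g) (2 * c + 2 * c').
Proof.
move=> hf hg s; rewrite pairD (le_trans (sqnD_le _ _))//.
by have := hf s; have := hg s; lra.
Qed.

Lemma dleZ a f c : dle f c -> dle (a *: f) (sqn a * c).
Proof.
move=> hf s; rewrite pairZ sqnM sqn_conj -mulrA.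
by rewrite ler_wpM2l ?sqn_ge0.
Qed.

Lemma dleN f c : dle f c -> dle (- f) c.
Proof. by move=> hf; have := dleZ (-1) hf; rewrite scaleN1r sqnN sqn1 mul1r. Qed.

Lemma dleB_sym f g c : dle (f - g) c -> dle (g - f) c.
Proof. by rewrite -(opprB f); exact: dleN. Qed.

Lemma dle_trans f g h c c' : dle (f - g) c -> dle (g - h) c' ->
  dle (f - h) (2 * c + 2 * c').
Proof. by move=> h1 h2; rewrite -(subrK g f) -addrA; exact: dleD. Qed.

Lemma dle_weak f c c' : c <= c' -> dle f c -> dle f c'.
Proof.
move=> cc hf s; apply: le_trans (hf s) _.
by rewrite ler_wpM2r// (pK.2 s).
Qed.

Lemma dle_sec s : dle (sec K s) (qn K s).
Proof. by move=> t; rewrite mulrC; exact: qf_CS. Qed.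

(** Tested on [s] itself, the bound reads [(qn K s)^2 <= c * qn K s]. With [dle_sec], dual norm and
    seminorm agree on sections. *)
Lemma qn_dle s c : 0 <= c -> dle (sec K s) c -> qn K s <= c.
Proof.
move=> c0 /(_ s); rewrite -/(qf K s s) qfE_qn // sqnC.
by have := pK.2 s; nra.
Qed.

Lemma dle0_eq0 f : (forall e, 0 < e -> dle f e) -> f = 0.
Proof.
move=> h; apply/funext => x; apply/sqn_eq0/ler_addgt0Pr => e e0.
have k0 := pK.2 [:: (1, x)].
(* Adding 1 keeps the denominator positive when [K x x = 0]; the device recurs below. *)
have := h (e / (qn K [:: (1, x)] + 1)); rewrite divr_gt0//; last by lra.
move=> /(_ isT [:: (1, x)]); rewrite pair1 sqn_conj add0r => /le_trans -> //.
by rewrite mulrAC -mulrA ler_piMr ?(ltW e0)// ler_pdivrMr; lra.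
Qed.

Definition sub_wseq s s' := s ++ scl (-1) s'.

Lemma sec_sub s s' : sec K (sub_wseq s s') = sec K s - sec K s'.
Proof. by rewrite sec_cat sec_scl scaleN1r. Qed.

(** The difference is [<s - s', t> + <s', t - t'>]. The differences have [qn] at most [4 e], and
    [e <= 1] gives [2 (c + 1)] for [t] and [s']; two products [8 (c + 1) e], each doubled by
    [sqnD_le], make 32. *)
Lemma qf_close f g c e s s' t t' : 0 <= c -> 0 < e <= 1 ->
    dle f c -> dle g c ->
    dle (f - sec K s) e -> dle (f - sec K s') e ->
    dle (g - sec K t) e -> dle (g - sec K t') e ->
  sqn (qf K s t - qf K s' t') <= 32 * (c + 1) * e.
Proof.
move=> c0 /andP[e0 e1] hf hg hs hs' ht ht'.
have q1 : qn K (sub_wseq s s') <= 4 * e.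
  apply: qn_dle; first lra.
  rewrite sec_sub; apply: dle_weak (dle_trans (dleB_sym hs) hs'); lra.
have q2 : qn K (sub_wseq t t') <= 4 * e.
  apply: qn_dle; first lra.
  rewrite sec_sub; apply: dle_weak (dle_trans (dleB_sym ht) ht'); lra.
have q3 : qn K t <= 2 * (c + 1).
  apply: qn_dle; first lra.
  rewrite -[sec K t](subrK g); apply: dle_weak (dleD (dleB_sym ht) hg); lra.
have q4 : qn K s' <= 2 * (c + 1).
  apply: qn_dle; first lra.
  rewrite -[sec K s'](subrK f); apply: dle_weak (dleD (dleB_sym hs') hf); lra.
have -> : qf K s t - qf K s' t' =
    qf K (sub_wseq s s') t + qf K s' (sub_wseq t t').
  rewrite qf_catl qf_catr qf_scll qf_sclr rmorphN1; ring.
apply: le_trans (sqnD_le _ _) _.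
have := qf_CS (sub_wseq s s') t pK; have := qf_CS s' (sub_wseq t t') pK.
have [p1 p2] := (pK.2 (sub_wseq s s'), pK.2 (sub_wseq t t')).
have [p3 p4] := (pK.2 t, pK.2 s').
have := ler_pM p1 p3 q1 q3; have := ler_pM p4 p2 q4 q2; lra.
Qed.

Definition approx f u :=
  forall e, 0 < e -> exists N, forall n, (N <= n)%N -> dle (f - sec K (u n)) e.

(* The space of [K] is realized as the closure, in this dual norm, of the
   sections: convergence there is pointwise, so limits are again functions. *)
Definition in_rkhs f := forall e, 0 < e -> exists s, dle (f - sec K s) e.

Lemma approx_in f u : approx f u -> in_rkhs f.
Proof. by move=> fu e /fu[N /(_ _ (leqnn N))]; exists (u N). Qed.

Lemma in_approx f : in_rkhs f -> exists u, approx f u.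
Proof.
move=> hf.
have /choice[u hu] : forall n, exists s, dle (f - sec K s) n.+1%:R^-1.
  by move=> n; apply: hf; rewrite invr_gt0.
exists u => e /natSinv_lt[N hN]; exists N => n /hN/ltW en.
exact: dle_weak en (hu n).
Qed.

Lemma approx_sec s : approx (sec K s) (fun=> s).
Proof.
move=> e e0; exists 0%N => n _; rewrite subrr => t.
by rewrite /pair big1 ?sqn0 ?mulr_ge0 ?(ltW e0) ?(pK.2 t)// => p _; rewrite conjC0 mulr0.
Qed.

Lemma approx_lin a f g u v : approx f u -> approx g v ->
  approx (a *: f + g) (fun n => scl a (u n) ++ v n).
Proof.
move=> fu gv e e0; have a0 := sqn_ge0 a.
have e1 : 0 < e / 4 / (sqn a + 1) by rewrite divr_gt0//; lra.
have e2 : 0 < e / 4 by lra.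
have [[N hN] [M hM]] := (fu _ e1, gv _ e2).
exists (maxn N M) => n; rewrite geq_max => /andP[/hN h1 /hM h2].
rewrite sec_cat sec_scl opprD addrACA -scalerBr.
apply: dle_weak (dleD (dleZ a h1) h2).
have : sqn a * (e / 4 / (sqn a + 1)) <= e / 4.
  by rewrite mulrCA ler_piMr ?(ltW e2)// ler_pdivrMr; lra.
lra.
Qed.

Lemma in_bounded f : in_rkhs f -> exists2 c, 0 <= c & dle f c.
Proof.
move=> /(_ 1 ltr01)[s hs]; exists (2 * 1 + 2 * qn K s).
  by have := pK.2 s; lra.
by rewrite -[f](subrK (sec K s)); exact: dleD hs (dle_sec s).
Qed.

(** With [u' = u] and [v' = v] this is the Cauchy property; otherwise it makes the limit independent
    of the approximating sequences. *)
Lemma qf_approx f g u v u' v' e : approx f u -> approx f u' ->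
    approx g v -> approx g v' -> 0 < e ->
  exists N, forall m n, (N <= m)%N -> (N <= n)%N ->
    sqn (qf K (u m) (v m) - qf K (u' n) (v' n)) <= e.
Proof.
move=> fu fu' gv gv' e0.
have [c c0 hf] := in_bounded (approx_in fu).
have [c' c0' hg] := in_bounded (approx_in gv).
pose d := Num.min 1 (e / (32 * (c + c' + 1))).
have d0 : 0 < d by rewrite lt_min ltr01 divr_gt0//; lra.
have [[N1 h1] [N2 h2]] := (fu _ d0, fu' _ d0).
have [[N3 h3] [N4 h4]] := (gv _ d0, gv' _ d0).
exists (maxn (maxn N1 N2) (maxn N3 N4)) => m n.
rewrite !geq_max => /andP[/andP[m1 m2] /andP[m3 m4]] /andP[/andP[n1 n2] /andP[n3 n4]].
apply: le_trans (qf_close (c := c + c') (e := d) _ _ _ _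
  (h1 _ m1) (h2 _ n2) (h3 _ m3) (h4 _ n4)) _.
- lra.
- by rewrite d0 ge_min lexx.
- by apply: dle_weak hf; lra.
- by apply: dle_weak hg; lra.
- by rewrite mulrC -ler_pdivlMr ?ge_min ?lexx ?orbT//; lra.
Qed.

(** Quantifying over all approximating sequences builds independence of the choice into the value;
    [ip_tends] excludes the default 0 on functions that have such sequences. *)
Definition ip f g : R[i] :=
  xget 0 [set z | forall u v, approx f u -> approx g v ->
                    tends (fun n => qf K (u n) (v n)) z].

Lemma ip_tends f g u v : approx f u -> approx g v ->
  tends (fun n => qf K (u n) (v n)) (ip f g).
Proof.
move=> fu gv; rewrite /ip; case: xgetP => [z _ /(_ u v fu gv)//|noz].
have [z uvz] : exists z, tends (fun n => qf K (u n) (v n)) z.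
  by apply: cauchy_tends => e e0; exact: (qf_approx fu fu gv gv e0).
case: (noz z) => u' v' fu' gv' e e0.
have e4 : 0 < e / 4 by lra.
have [[N hN] [M hM]] := (uvz _ e4, qf_approx fu' fu gv' gv e4).
exists (maxn N M) => n; rewrite geq_max => /andP[nN nM].
have := sqnD_le (qf K (u' n) (v' n) - qf K (u n) (v n)) (qf K (u n) (v n) - z).
by rewrite addrA subrK; have := hN n nN; have := hM n n nM nM; lra.
Qed.

Lemma ip_lin a f g h : in_rkhs f -> in_rkhs g -> in_rkhs h ->
  ip (a *: f + g) h = a * ip f h + ip g h.
Proof.
move=> /in_approx[u fu] /in_approx[v gv] /in_approx[w hw].
apply: (tends_unique (ip_tends (approx_lin a fu gv) hw)).
have := tendsD (tendsZ a (ip_tends fu hw)) (ip_tends gv hw).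
rewrite (_ : (fun n => _ + _) = (fun n => qf K (scl a (u n) ++ v n) (w n)))//.
by apply/funext => n; rewrite qf_catl qf_scll.
Qed.

Lemma ip_sym f g : in_rkhs f -> in_rkhs g -> ip f g = (ip g f)^*.
Proof.
move=> /in_approx[u fu] /in_approx[v gv].
apply: (tends_unique (ip_tends fu gv)).
have := tends_conj (ip_tends gv fu).
rewrite (_ : (fun n => _) = (fun n => qf K (u n) (v n)))//.
by apply/funext => n; rewrite -qf_sym //.
Qed.

Lemma ip_ge0 f : in_rkhs f -> 0 <= ip f f.
Proof.
move=> /in_approx[u fu]; apply: tends_ge0 (ip_tends fu fu) => n.
by rewrite qfE_qn // lecR (pK.2 _).
Qed.

Lemma ip_sec f s : in_rkhs f -> ip f (sec K s) = (pair s f)^*.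
Proof.
move=> /in_approx[u fu].
apply: (tends_unique (ip_tends fu (approx_sec s))) => e e0.
have q0 := pK.2 s.
have e1 : 0 < e / (qn K s + 1) by rewrite divr_gt0//; lra.
have [N hN] := fu _ e1; exists N => n /hN /(_ s) h.
rewrite qf_sym // -rmorphB sqn_conj sqnB -pairB (le_trans h)//.
by rewrite mulrAC -mulrA ler_piMr ?(ltW e0)// ler_pdivrMr; lra.
Qed.

(** With [ip_dle], compares the dual norm and the norm of [ip] up to a factor 2, enough for
    definiteness, completeness and continuous evaluation. The sharp bound is [pair_val_le], from
    Cauchy-Schwarz. *)
Lemma dle_ip f : in_rkhs f -> dle f (2 * complex.Re (ip f f)).
Proof.
move=> hf s; have [u fu] := in_approx hf.
have q0 := pK.2 s.
apply/ler_addgt0Pr => e e0.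
have e1 : 0 < e / 6 / (qn K s + 1) by rewrite divr_gt0//; lra.
have e2 : 0 < (e / 6 / (qn K s + 1)) ^+ 2 by rewrite exprn_gt0.
have [[N hN] [M hM]] := (fu _ e1, ip_tends fu fu e2).
have := hN _ (leq_maxl N M); have := hM _ (leq_maxr N M).
set n := maxn N M; set d := _ / _ => h1 h2.
have h3 : qn K (u n) <= complex.Re (ip f f) + d.
  have := le_trans (Re_le_sqn _) h1; rewrite cReD cReN -/(qn K (u n)).
  rewrite -ler_sqrt ?sqr_ge0// !sqrtr_sqr (gtr0_norm e1) ler_norml => /andP[_].
  by rewrite lerBlDl.
have := dleD h2 (dle_sec (u n)) s; rewrite subrK => /le_trans; apply.
have h4 : (6 * d) * qn K s <= e.
  have -> : 6 * d * qn K s = e * (qn K s / (qn K s + 1)) by rewrite /d; field; lra.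
  by rewrite ler_piMr ?(ltW e0)// ler_pdivrMr; lra.
have := ler_wpM2r q0 h3; lra.
Qed.

Lemma ip_dle f c : in_rkhs f -> 0 <= c -> dle f c -> complex.Re (ip f f) <= 2 * c.
Proof.
move=> /in_approx[u fu] c0 hf; apply: tends_Re_le (ip_tends fu fu) => e e0.
have e2 : 0 < e / 2 by lra.
have [N hN] := fu _ e2; exists N => n /hN h.
apply: qn_dle; first lra.
rewrite -[sec K _](subrK f); apply: dle_weak (dleD (dleB_sym h) hf); lra.
Qed.

Lemma in_rkhs_lin a f g : in_rkhs f -> in_rkhs g -> in_rkhs (a *: f + g).
Proof.
by move=> /in_approx[u fu] /in_approx[v gv]; exact: approx_in (approx_lin a fu gv).
Qed.

Lemma in_sec s : in_rkhs (sec K s).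
Proof. exact: approx_in (approx_sec s). Qed.

Lemma tends_pair s (F : nat -> X -> R[i]) f :
  (forall x, tends (F ^~ x) (f x)) -> tends (fun n => pair s (F n)) (pair s f).
Proof.
move=> Ff; elim: s => [|p s IH].
  rewrite /pair big_nil (_ : (fun n => _) = (fun=> 0)); first exact: tends_cst.
  by apply/funext => n; rewrite big_nil.
rewrite pair_cons.
have := tendsD (tendsZ p.1 (tends_conj (Ff p.2))) IH.
rewrite (_ : (fun n => _) = (fun n => pair (p :: s) (F n)))//.
by apply/funext => n; rewrite pair_cons.
Qed.

(** The pointwise limit is also the limit in the dual norm: [pair s] sees finitely many points, so
    the Cauchy bound passes to the limit for each [s], with a rank independent of [s]. *)
Lemma dle_complete (F : nat -> X -> R[i]) : (forall n, in_rkhs (F n)) ->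
    (forall e, 0 < e -> exists N, forall m n, (N <= m)%N -> (N <= n)%N ->
       dle (F m - F n) e) ->
  exists2 f, in_rkhs f & forall e, 0 < e -> exists N, forall n, (N <= n)%N ->
    dle (F n - f) e.
Proof.
move=> Fin cF.
have /choice[f Ff] : forall x, exists z, tends (F ^~ x) z.
  move=> x; apply: cauchy_tends => e e0.
  have k0 := pK.2 [:: (1, x)].
  have e1 : 0 < e / (qn K [:: (1, x)] + 1) by rewrite divr_gt0//; lra.
  have [N hN] := cF _ e1; exists N => m n mN nN.
  have := hN m n mN nN [:: (1, x)]; rewrite pair1 sqn_conj => /le_trans -> //.
  by rewrite mulrAC -mulrA ler_piMr ?(ltW e0)// ler_pdivrMr; lra.
have conv e : 0 < e -> exists N, forall n, (N <= n)%N -> dle (F n - f) e.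
  move=> e0; have e4 : 0 < e / 4 by lra.
  have [N hN] := cF _ e4; exists N => n nN s.
  apply/ler_addgt0Pr => d d0; have d2 : 0 < d / 2 by lra.
  have [M hM] := tends_pair s Ff d2.
  have := hM _ (leq_maxr N M); have := hN _ _ nN (leq_maxl N M) s.
  rewrite !pairB; set z := pair s (F (maxn N M)).
  have := sqnD_le (pair s (F n) - z) (z - pair s f); rewrite addrA subrK.
  have := pK.2 s; nra.
exists f => // e e0; have e4 : 0 < e / 4 by lra.
have [N hN] := conv _ e4.
have [t ht] := Fin N _ e4; exists t.
by apply: dle_weak (dle_trans (dleB_sym (hN N (leqnn N))) ht); lra.
Qed.

Definition hpred : {pred X -> R[i]} := fun f => `[< in_rkhs f >].

Lemma mem_hpred f : (f \in hpred) = `[< in_rkhs f >].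
Proof. by []. Qed.

Lemma hpred_submod : GRing.submod_closed hpred.
Proof.
split=> [|a f g]; rewrite !mem_hpred.
  apply/asboolP; rewrite (_ : 0 = sec K [::]); first exact: in_sec.
  by apply/funext => x; rewrite /sec big_nil.
by move=> /asboolP hf /asboolP hg; apply/asboolP; exact: in_rkhs_lin.
Qed.

HB.instance Definition _ :=
  GRing.isSubmodClosed.Build R[i] (X -> R[i]) hpred hpred_submod.

Definition hspace := {f : X -> R[i] | hpred f}.
HB.instance Definition _ := SubType.copy hspace {f : X -> R[i] | hpred f}.
HB.instance Definition _ := gen_eqMixin hspace.
HB.instance Definition _ := gen_choiceMixin hspace.
HB.instance Definition _ := [SubChoice_isSubLmodule of hspace by <:].

Definition hdot (f g : hspace) : R[i] := ip (val f) (val g).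

Lemma hspace_in (f : hspace) : in_rkhs (val f).
Proof. by exact/asboolP/(valP f). Qed.

Lemma hdot_bilinear :
  bilinear_for ( *%R : GRing.Scale.law _ _) (Num.conj \; *%R : GRing.Scale.law _ _) hdot.
Proof.
split=> [g a f f'|g a f f'] /=; rewrite /hdot linearP.
  by apply: ip_lin; exact: hspace_in.
rewrite ip_sym ?ip_lin ?rmorphD ?rmorphM /= -?ip_sym//; try exact: hspace_in.
by apply: in_rkhs_lin; exact: hspace_in.
Qed.

HB.instance Definition _ := bilinear_isBilinear.Build R[i] hspace hspace R[i]
  ( *%R : GRing.Scale.law _ _) (Num.conj \; *%R : GRing.Scale.law _ _) hdot hdot_bilinear.

Lemma hdot_herm (f g : hspace) : hdot f g = (-1) ^+ false * (hdot g f)^*.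
Proof. by rewrite expr0 mul1r /hdot ip_sym//; exact: hspace_in. Qed.

HB.instance Definition _ :=
  isHermitianSesquilinear.Build R[i] hspace false Num.conj hdot hdot_herm.

Lemma hdot_gt0 (f : hspace) : f != 0 -> 0 < hdot f f.
Proof.
move=> f0; rewrite lt_def ip_ge0 ?andbT; last exact: hspace_in.
apply: contra f0 => /eqP f0; apply/eqP/val_inj; rewrite linear0.
apply: dle0_eq0 => e e0; apply: dle_weak (dle_ip (hspace_in f)).
by rewrite -/(hdot f f) f0 mulr0 ltW.
Qed.

HB.instance Definition _ := isDotProduct.Build R[i] hspace hdot hdot_gt0.

Lemma hspace_complete : hcomplete (hdot : {dot hspace for Num.conj}).
Proof.
apply/hcompleteP => x cx.
have [n|e e0|f fin fx] := @dle_complete (fun n => val (x n)).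
- exact: hspace_in.
- have e2 : 0 < e / 2 by lra.
  have [N hN] := cx _ e2; exists N => m n mN nN.
  rewrite -linearB; apply: dle_weak (dle_ip (hspace_in _)).
  by have := hN m n mN nN; rewrite /nsq /= /hdot; lra.
have fP : hpred f by apply/asboolP.
exists (Sub f fP) => e e0; have e4 : 0 < e / 4 by lra.
have [N hN] := fx _ e4; exists N => n /hN h.
have xE : val (x n - Sub f fP) = val (x n) - f by rewrite linearB.
rewrite /nsq /= /hdot xE; apply: le_lt_trans (ip_dle _ _ h) _; try lra.
by rewrite -xE; exact: hspace_in.
Qed.

Lemma hspace_eval_le (f : hspace) x :
  sqn (val f x) <= nsq (hdot : {dot hspace for Num.conj}) f * (2 * qn K [:: (1, x)]).
Proof.
have := dle_ip (hspace_in f) [:: (1, x)]; rewrite pair1 sqn_conj /nsq /= /hdot; lra.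
Qed.

Lemma hspace_eval x : Defs.eval_continuous (hdot : {dot hspace for Num.conj}) x.
Proof.
move=> f e e0; have k0 := pK.2 [:: (1, x)].
have d0 : 0 < e ^+ 2 / (2 * qn K [:: (1, x)] + 1).
  by rewrite divr_gt0 ?exprn_gt0//; lra.
exists (Num.sqrt (e ^+ 2 / (2 * qn K [:: (1, x)] + 1))); first by rewrite sqrtr_gt0.
move=> g; rewrite hnorm_lt ?sqrtr_gt0// sqr_sqrtr ?(ltW d0)// => h.
rewrite norm_ltC//.
have -> : val g x - val f x = val (g - f) x by rewrite linearB.
apply: le_lt_trans (hspace_eval_le _ _) _.
have [->|n0] := eqVneq (nsq (hdot : {dot hspace for Num.conj}) (g - f)) 0.
  by rewrite mul0r exprn_gt0.
have {}n0 : 0 < nsq (hdot : {dot hspace for Num.conj}) (g - f).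
  by rewrite lt_def n0 nsq_ge0.
move: h; rewrite ltr_pdivlMr; last lra.
by apply: le_lt_trans; rewrite ler_pM2l//; lra.
Qed.

Definition hrkhs : rkhs R X := RKHS hspace_complete hspace_eval.

Lemma kernel_hrkhs : kernel hrkhs = K.
Proof.
have ksecE x : val (ksec hrkhs x) = K ^~ x.
  rewrite /ksec; have kP : hpred (K ^~ x) by apply/asboolP; rewrite -sec1; exact: in_sec.
  have kx (f : hrkhs) : val f x = rkhs_dot hrkhs f (Sub (K ^~ x) kP).
    by rewrite /= /hdot SubK -sec1 ip_sec ?pair1 ?conjCK//; exact: hspace_in.
  case: xgetP => [g _ /= hg|/(_ (Sub (K ^~ x) kP)) []//].
  have -> : g = Sub (K ^~ x) kP; last by rewrite SubK.
  by apply: (@dot_inj _ _ (rkhs_dot hrkhs)) => f; exact: etrans (esym (hg f)) (kx f).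
apply/funext => x; apply/funext => y; rewrite /kernel /= /hdot !ksecE.
by rewrite -[K ^~ x]sec1 ip_sec ?pair1 ?conjCK// -sec1; exact: in_sec.
Qed.

End MooreAronszajn.

Lemma moore_aronszajn (R : realType) (X : Type) (K : X -> X -> R[i]) :
  psd K -> exists H : rkhs R X, kernel H = K.
Proof. by move=> pK; exists (hrkhs pK); exact: kernel_hrkhs. Qed.

(** * Kernel sections and membership in an RKHS *)

Section Gram.
Variables (R : realType) (U : lmodType R[i]) (dot : {dot U for Num.conj}).
Variables (X : Type) (v : X -> U).
Implicit Types (s t : seq (R[i] * X)).

Definition comb s : U := \sum_(p <- s) p.1 *: v p.2.
Definition gram (x y : X) : R[i] := dot (v y) (v x).

Lemma dot_comb s w : dot (comb s) w = pair s (fun x => dot w (v x)).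
Proof.
rewrite /comb dot_suml; apply: eq_bigr => p _.
by rewrite dotZl -dot_sym.
Qed.

Lemma qf_gram s t : qf gram s t = dot (comb s) (comb t).
Proof.
rewrite dot_comb; congr pair; apply/funext => x.
rewrite /sec /comb dot_suml; apply: eq_bigr => p _.
by rewrite dotZl.
Qed.

Lemma qn_gram s : qn gram s = nsq dot (comb s).
Proof. by rewrite /qn qf_gram. Qed.

Lemma psd_gram : psd gram.
Proof. by split=> [x y|s]; [exact: dot_sym | rewrite qn_gram nsq_ge0]. Qed.

Lemma comb_cat s t : comb (s ++ t) = comb s + comb t.
Proof. exact: big_cat. Qed.

Lemma comb_scl a s : comb (scl a s) = a *: comb s.
Proof.
by rewrite /comb big_map scaler_sumr; apply: eq_bigr => p _; rewrite scalerA.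
Qed.

End Gram.

Lemma riesz (R : realType) (U : lmodType R[i]) (dot : {dot U for Num.conj})
    (L : U -> R[i]) (c : R) :
  hcomplete dot -> 0 <= c -> scalar L ->
  (forall u, sqn (L u) <= c * nsq dot u) ->
  exists2 g, forall u, L u = dot u g & nsq dot g <= c.
Proof.
move=> Uc c0 Llin Lc.
have [|t u v _ _ -> ->|u _ ->|g [hg gc _]] :=
  @riesz_graph _ _ dot Uc (fun u a => a = L u) c c0.
- have := Llin (-1) 0 0; by rewrite scaler0 addr0 mulN1r addNr.
- exact: esym (Llin t u v).
- exact: Lc.
by exists g => // u; exact: hg.
Qed.

Section RKHSTheory.
Variables (R : realType) (X : Type) (H : rkhs R X).
Local Notation D := (rkhs_dot H).
Local Notation k := (kernel H).
Implicit Types (f g : H) (s : seq (R[i] * X)) (x y : X).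

Lemma val_lin a f g x : val (a *: f + g) x = a * val f x + val g x.
Proof. by rewrite linearP. Qed.

Lemma val_scale a f x : val (a *: f) x = a * val f x.
Proof. by rewrite linearZ. Qed.

Lemma eval_bounded x : exists2 c, 0 <= c & forall f, sqn (val f x) <= c * nsq D f.
Proof.
have [d d0 hd] := rkhs_eval (r := H) x 0 ltr01.
exists (2 / d ^+ 2); first by rewrite divr_ge0// exprn_ge0// ltW.
move=> f; have [->|f0] := eqVneq f 0.
  by rewrite linear0 nsq0 mulr0 sqn0.
have n0 : 0 < nsq D f.
  rewrite lt_def nsq_ge0 andbT; apply: contra f0 => /eqP nf.
  by apply/eqP/(nsq_eq0 (dot := D)); rewrite nf.
(* [r *: f] has squared norm [d ^+ 2 / 2], strictly inside the ball; undoing the scaling turns the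
   tolerance 1 into [2 / d ^+ 2]. *)
pose r := Num.sqrt (d ^+ 2 / (2 * nsq D f)).
have r2 : r ^+ 2 = d ^+ 2 / (2 * nsq D f).
  by rewrite sqr_sqrtr// ltW// divr_gt0 ?exprn_gt0//; lra.
have := hd (r%:C *: f); rewrite hnorm_lt// !subr0 nsqZ sqnC r2.
have -> : d ^+ 2 / (2 * nsq D f) * nsq D f = d ^+ 2 / 2 by field; lra.
have d2 : 0 < d ^+ 2 by rewrite exprn_gt0.
move=> /(_ ltac:(lra)); rewrite linearZ linear0 subr0.
rewrite norm_ltC// expr1n sqnM sqnC r2 => h.
have -> : 2 / d ^+ 2 * nsq D f = (d ^+ 2 / (2 * nsq D f))^-1 by field; lra.
have dn : 0 < d ^+ 2 / (2 * nsq D f) by rewrite divr_gt0//; lra.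
by rewrite -div1r ler_pdivlMr// mulrC ltW.
Qed.

Lemma ksecP f x : val f x = D f (ksec H x).
Proof.
rewrite /ksec; case: xgetP => [g _ /(_ f)//|nog].
have [c c0 hc] := eval_bounded x.
have [|g hg _] := riesz (@rkhs_complete _ _ H) c0 _ hc.
  by move=> a u v; rewrite linearP.
by case: (nog g) => h; rewrite hg.
Qed.

Lemma ksecE x y : val (ksec H y) x = k x y.
Proof. exact: ksecP. Qed.

Lemma psd_kernel : psd k.
Proof. exact: psd_gram. Qed.

Lemma nsq_comb s : nsq D (comb (ksec H) s) = qn k s.
Proof. by rewrite -qn_gram. Qed.

Lemma dot_combk s f : D (comb (ksec H) s) f = pair s (val f).
Proof. by rewrite dot_comb; congr pair; apply/funext => x; rewrite -ksecP. Qed.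

(** The bound makes [comb s |-> pair s F] a bounded functional on the span of the sections; its
    representing vector takes the value [F x] at [x]. The last clause places that vector in the
    closure of the span. *)
Lemma rkhs_interpolation (F : X -> R[i]) (c : R) : 0 <= c ->
  (forall s, sqn (pair s F) <= c * qn k s) ->
  exists g, [/\ val g = F, nsq D g <= c &
    forall e : R, 0 < e -> exists s, nsq D (g - comb (ksec H) s) < e].
Proof.
move=> c0 Fc.
have [||_ _ [s [-> ->]]|g [hg gc near]] := @riesz_graph _ _ D (@rkhs_complete _ _ H)
   (fun u a => exists s, u = comb (ksec H) s /\ a = pair s F) c c0.
- by exists [::]; rewrite /comb /pair !big_nil.
- move=> t _ _ _ _ [s [-> ->]] [s' [-> ->]]; exists (scl t s ++ s').
  by rewrite comb_cat comb_scl pair_cat pair_scl.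
- by rewrite nsq_comb.
exists g; split => //.
  apply/funext => x; apply: (inv_inj (@conjCK _)); rewrite -[RHS]pair1 ksecP -dot_sym.
  by apply/esym/hg; exists [:: (1, x)]; rewrite /comb big_seq1 scale1r.
move=> e /near[_ [_ [[s [-> _]] h]]]; exists s.
by rewrite nsqB_sym.
Qed.

Lemma pair_val_le f s : sqn (pair s (val f)) <= nsq D f * qn k s.
Proof. by rewrite -dot_combk mulrC -nsq_comb; exact: dot_CS. Qed.

(** [f] is the interpolant of its own values. *)
Lemma comb_dense f (e : R) : 0 < e -> exists s, nsq D (f - comb (ksec H) s) < e.
Proof.
have [g [gf _ near]] := rkhs_interpolation (nsq_ge0 D f) (pair_val_le f).
by rewrite -(val_inj gf); exact: near.
Qed.

Lemma mem_rkhsP (F : X -> R[i]) :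
  F \in rkhs_pred H <->
  exists2 c : R, 0 <= c & psd (fun x y => c%:C * k x y - F x * (F y)^*).
Proof.
split=> [FH|[c c0 /(psd_sub_rank1 _ _ psd_kernel.1)/(rkhs_interpolation c0)[g [<- _ _]]]].
  exists (nsq D (Sub F FH)); first exact: nsq_ge0.
  apply/(psd_sub_rank1 _ _ psd_kernel.1) => s.
  by have := pair_val_le (Sub F FH) s; rewrite SubK.
exact: (valP g).
Qed.

End RKHSTheory.

(** * Hilbert tensor products and the RKHA criterion *)

Lemma exists_linear (R : nzRingType) (U V : lmodType R) (f : U -> V) :
  linear f -> exists L : {linear U -> V}, L =1 f.
Proof.
move=> flin; pose M := GRing.isLinear.Build R U V *:%R f flin.
by exists (HB.pack f M : {linear U -> V}).
Qed.

Lemma exists_bilinear (R : comNzRingType) (U V W : lmodType R) (f : U -> V -> W) :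
  (forall v, linear (f ^~ v)) -> (forall u, linear (f u)) ->
  exists B : {bilinear U -> V -> W}, forall u v, B u v = f u v.
Proof.
move=> fl fr; pose M := bilinear_isBilinear.Build R U V W
  ( *:%R : GRing.Scale.law R W) ( *:%R : GRing.Scale.law R W) f (fl, fr).
by exists (HB.pack f M : {bilinear U -> V -> W}).
Qed.

Section Tensor.
Variables (R : realType) (X1 X2 : Type) (H1 : rkhs R X1) (H2 : rkhs R X2).
Variable T : rkhs R (X1 * X2).
Hypothesis kT : kernel T = tensor_kernel (kernel H1) (kernel H2).
Local Notation D1 := (rkhs_dot H1).
Local Notation D2 := (rkhs_dot H2).
Local Notation DT := (rkhs_dot T).

(** Telescoping, with [F], [G] the rank-one kernels and [a], [b] the squared norms of [f], [g]: [a b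
    k1 k2 - F G = (a k1 - F) b k2 + F (b k2 - G)]. *)
Lemma tensor_fun_le (f : H1) (g : H2) s :
  sqn (pair s (fun z => val f z.1 * val g z.2)) <=
  nsq D1 f * nsq D2 g * qn (kernel T) s.
Proof.
have pf := (psd_sub_rank1 (val f) (nsq D1 f) (psd_kernel H1).1).2 (pair_val_le f).
have pg := (psd_sub_rank1 (val g) (nsq D2 g) (psd_kernel H2).1).2 (pair_val_le g).
apply: (psd_sub_rank1 _ _ (psd_kernel T).1).1 s.
have := psdD (psd_tensor pf (psdZ (nsq_ge0 D2 g) (psd_kernel H2)))
             (psd_tensor (psd_rank1 (val f)) pg).
congr psd; apply/funext => x; apply/funext => y.
by rewrite kT /tensor_kernel !rmorphM /=; ring.
Qed.

Lemma tensor_mem (f : H1) (g : H2) :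
  exists t : T, val t = (fun z => val f z.1 * val g z.2) /\
    nsq DT t <= nsq D1 f * nsq D2 g.
Proof.
have [t [tE tn _]] := rkhs_interpolation (H := T)
  (mulr_ge0 (nsq_ge0 D1 f) (nsq_ge0 D2 g)) (tensor_fun_le f g).
by exists t.
Qed.

Lemma tensor_bilinear : exists tau : {bilinear H1 -> H2 -> T},
  forall f g, val (tau f g) = (fun z => val f z.1 * val g z.2).
Proof.
have /choice[t0 ht] : forall p : H1 * H2, exists t : T,
    val t = (fun z => val p.1 z.1 * val p.2 z.2).
  by move=> [f g]; have [t [tE _]] := tensor_mem f g; exists t.
have [g a f f'|f a g g'|tau tauE] := @exists_bilinear _ H1 H2 T (fun f g => t0 (f, g)).
- by apply: val_inj; apply/funext => z; rewrite val_lin !ht /= val_lin mulrDl -mulrA.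
- by apply: val_inj; apply/funext => z; rewrite val_lin !ht /= val_lin mulrDr mulrCA.
by exists tau => f g; rewrite tauE ht.
Qed.

Variable tau : {bilinear H1 -> H2 -> T}.
Hypothesis tauE : forall f g, val (tau f g) = (fun z => val f z.1 * val g z.2).

Lemma nsq_tensor_le f g : nsq DT (tau f g) <= nsq D1 f * nsq D2 g.
Proof.
by have [t [tE]] := tensor_mem f g; rewrite -(val_inj (etrans tE (esym (tauE f g)))).
Qed.

Lemma tensor_ksec x y : tau (ksec H1 x) (ksec H2 y) = ksec T (x, y).
Proof.
apply: val_inj; rewrite tauE; apply/funext => z.
by rewrite !ksecE kT.
Qed.

(* Both factors are treated in turn: as a functional of one factor the left-hand
   side is bounded, and its representing vector is computed on kernel sections. *)
Lemma dot_tensor f f' g g' : DT (tau f g) (tau f' g') = D1 f f' * D2 g g'.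
Proof.
have step1 h y : DT (tau h (ksec H2 y)) (tau f g) = (val g y)^* * D1 h f.
  have b0 : 0 <= nsq D2 (ksec H2 y) * nsq DT (tau f g).
    by rewrite mulr_ge0 ?nsq_ge0.
  have [a u v|u|w hw _] := riesz (@rkhs_complete _ _ H1) b0
     (L := fun h => DT (tau h (ksec H2 y)) (tau f g)).
  - by rewrite linearDl linearZl_LR dotDl dotZl.
  - apply: le_trans (dot_CS _ _ _) _.
    by rewrite mulrAC ler_wpM2r ?nsq_ge0// mulrC nsq_tensor_le.
  rewrite hw -dotZr; congr (D1 _ _); apply: val_inj; rewrite linearZ.
  apply/funext => x; rewrite ksecP dot_sym -hw tensor_ksec -dot_sym -ksecP tauE /=.
  exact: mulrC.
have b0 : 0 <= nsq D1 f' * nsq DT (tau f g) by rewrite mulr_ge0 ?nsq_ge0.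
have [a u v|u|w hw _] := riesz (@rkhs_complete _ _ H2) b0
   (L := fun h => DT (tau f' h) (tau f g)).
- by rewrite linearDr linearZr_LR dotDl dotZl.
- apply: le_trans (dot_CS _ _ _) _; rewrite mulrAC.
  by rewrite ler_wpM2r ?nsq_ge0// nsq_tensor_le.
rewrite dot_sym hw (_ : w = D1 f f' *: g) -?dot_sym ?dotZl//.
apply: val_inj; apply/funext => y.
rewrite val_scale (ksecP w) (dot_sym _ w) -hw step1 rmorphM /= conjCK.
by rewrite -dot_sym mulrC.
Qed.

Lemma tensor_hilbert : hilbert_tensor D1 D2 DT tau.
Proof.
split; [exact: rkhs_complete | exact: dot_tensor | move=> t e e0].
have [s hs] := comb_dense t (exprn_gt0 2 e0).
exists [seq (p.1 *: ksec H1 p.2.1, ksec H2 p.2.2) | p <- s].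
rewrite hnorm_lt// big_map (eq_bigr (fun p => p.1 *: ksec T p.2))// => p _ /=.
by rewrite linearZl_LR tensor_ksec -surjective_pairing.
Qed.

End Tensor.

Lemma bounded_nsq (R : realType) (U V : lmodType R[i]) (dU : {dot U for Num.conj})
    (dV : {dot V for Num.conj}) (L : {linear U -> V}) :
  bounded_linear dU dV L ->
  exists2 c : R, 0 <= c & forall u, nsq dV (L u) <= c * nsq dU u.
Proof.
move=> [c hc]; exists (c ^+ 2) => [|u]; first exact: sqr_ge0.
rewrite -!sqr_hnorm -exprMn lerXn2r ?nnegrE ?sqrtr_ge0//.
by apply: le_trans (hc u); rewrite sqrtr_ge0.
Qed.

Lemma nsq_bounded (R : realType) (U V : lmodType R[i]) (dU : {dot U for Num.conj})
    (dV : {dot V for Num.conj}) (L : {linear U -> V}) (c : R) :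
  0 <= c -> (forall u, nsq dV (L u) <= c * nsq dU u) -> bounded_linear dU dV L.
Proof.
move=> c0 h; exists (Num.sqrt c) => u.
by rewrite /hnorm -sqrtrM// ler_wsqrtr// h.
Qed.

Section RKHA.
Variables (R : realType) (X : Type) (H : rkhs R X).
Local Notation D := (rkhs_dot H).
Local Notation k := (kernel H).

Lemma psd_sub_sqrP (K : X -> X -> R[i]) (c : R) : psd K ->
  psd (fun x y => c%:C * K x y - K x y ^+ 2) <->
  forall s, qn (fun x y => K x y * K x y) s <= c * qn K s.
Proof.
move=> [hK _].
have E : (fun x y => c%:C * K x y - K x y ^+ 2) =
    (fun x y => c%:C * K x y + (-1)%:C * (K x y * K x y)).
  by apply/funext => x; apply/funext => y; rewrite rmorphN1 mulN1r.
have qnE s : qn (fun x y => c%:C * K x y - K x y ^+ 2) s =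
    c * qn K s - qn (fun x y => K x y * K x y) s.
  by rewrite E /qn qfD !qfZ cReD !cRe_realM mulN1r.
split=> [[_ h] s|h]; first by rewrite -subr_ge0 -qnE.
split=> [x y|s]; last by rewrite qnE subr_ge0.
by rewrite rmorphB rmorphM rmorphXn /= -hK conjCreal.
Qed.

(** For the converse, [Delta] is built as the adjoint of pointwise multiplication, realized as
    restriction to the diagonal of functions on [X * X]. *)
Lemma rkhaP : rkha H <->
  exists2 c : R, 0 <= c & psd (fun x y => c%:C * k x y - k x y ^+ 2).
Proof.
split=> [[T [DT [tau [Delta [[_ tauE _] Db Dk]]]]]|].
  have [c c0 hc] := bounded_nsq Db; exists c => //.
  apply/(psd_sub_sqrP _ (psd_kernel H)) => s.
  have -> : (fun x y => k x y * k x y) = gram DT (fun x => tau (ksec H x) (ksec H x)).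
    by apply/funext => x; apply/funext => y; rewrite /gram tauE.
  rewrite qn_gram -nsq_comb (le_trans _ (hc _))// /comb linear_sum.
  rewrite [X in _ <= nsq _ X](eq_bigr
    (fun p => p.1 *: tau (ksec H p.2) (ksec H p.2)))// => p _.
  by rewrite linearZ Dk.
move=> [c c0 /(psd_sub_sqrP _ (psd_kernel H)) pc].
have [T kT] := moore_aronszajn (psd_tensor (psd_kernel H) (psd_kernel H)).
have [tau tauE] := tensor_bilinear kT.
(* On diagonal points the kernel of [T] is the square of [k], so the hypothesis bounds the
   restriction. *)
have diag_mem (F : T) : exists f : H, val f = (fun x => val F (x, x)) /\
    nsq D f <= c * nsq (rkhs_dot T) F.
  have [|s|f [fE fn _]] := @rkhs_interpolation _ _ H
    (fun x => val F (x, x)) (c * nsq (rkhs_dot T) F).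
  - by rewrite mulr_ge0 ?nsq_ge0.
  - pose s' := [seq (p.1, (p.2, p.2)) | p <- s].
    have -> : pair s (fun x => val F (x, x)) = pair s' (val F) by rewrite /pair big_map.
    apply: le_trans (pair_val_le F s') _.
    rewrite (mulrC c) -mulrA ler_wpM2l ?nsq_ge0//; apply: le_trans (pc s).
    rewrite kT /qn !qfE big_map le_eqVlt; apply/orP; left; apply/eqP; congr complex.Re.
    by apply: eq_bigr => p _; rewrite big_map.
  by exists f.
have /choice[m hm] := diag_mem.
have mE F x : val (m F) x = val F (x, x) by case: (hm F) => ->.
have /choice[d hd] : forall h : H, exists t : T,
    (forall F, D (m F) h = rkhs_dot T F t) /\ nsq (rkhs_dot T) t <= c * nsq D h.
  move=> h; have [|a u v|u|t tE tn] := riesz (@rkhs_complete _ _ T)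
    (L := fun F => D (m F) h) (c := c * nsq D h).
  - by rewrite mulr_ge0 ?nsq_ge0.
  - rewrite -dotZl -dotDl; congr (D _ h); apply: val_inj; apply/funext => x.
    by rewrite val_lin !mE val_lin.
  - apply: le_trans (dot_CS _ _ _) _; rewrite mulrAC ler_wpM2r ?nsq_ge0//.
    by case: (hm u).
  by exists t.
have [|Delta DeltaE] := @exists_linear _ H T d.
  move=> a u v; apply: (@dot_inj _ _ (rkhs_dot T)) => F.
  by rewrite -(hd _).1 !dotDr !dotZr !(hd _).1.
exists T, (rkhs_dot T), tau, Delta; split; first exact: tensor_hilbert.
  by apply: (nsq_bounded c0) => u; rewrite DeltaE; exact: (hd u).2.
move=> x; rewrite DeltaE (tensor_ksec kT tauE).
apply: (@dot_inj _ _ (rkhs_dot T)) => F.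
by rewrite -(hd _).1 -!ksecP mE.
Qed.

End RKHA.

(** * Pushouts *)

Section Pushout.
Variables (R : realType) (X S : Type) (H : rkhs R X) (phi : X -> S).
Local Notation D := (rkhs_dot H).
Local Notation M := (fiber_constant (H := H) phi).
Local Notation pk := (fiber_ksec H phi).

(** The functional [dot u f] on [M] is represented by some [g] in the closure of [M]; bounded
    evaluations make [M] closed, so [g] is the projection. *)
Lemma hproj_fiberP (f : H) :
  M (hproj D M f) /\ forall h, M h -> D (f - hproj D M f) h = 0.
Proof.
rewrite /hproj; case: xgetP => [g _ //|nog].
have [||u a [Mu ->]|g [hg _ near]] := @riesz_graph _ _ D (@rkhs_complete _ _ H)
   (fun u a => M u /\ a = D u f) (nsq D f) (nsq_ge0 D f).
- by split=> [x y _|]; rewrite ?linear0 ?dot0l.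
- move=> t u v _ _ [Mu ->] [Mv ->]; rewrite dotDl dotZl; split=> // x y xy.
  by rewrite !val_lin (Mu x y xy) (Mv x y xy).
- by rewrite mulrC; exact: dot_CS.
case: (nog g); split=> [x y xy|h Mh]; last first.
  by rewrite dotBl (dot_sym D f) (dot_sym D g) -(hg h (D h f) (conj Mh erefl)) subrr.
apply/eqP; rewrite -subr_eq0; apply/eqP/sqn_eq0/ler_addgt0Pr => e e0.
have [[c c0 hc] [d d0 hd]] := (eval_bounded H x, eval_bounded H y).
have e1 : 0 < e / 2 / (c + d + 1) by rewrite divr_gt0//; lra.
have [u [_ [[Mu _] h]]] := near _ e1.
have := hc (g - u); have := hd (g - u); rewrite nsqB_sym in h.
have valB z : val (g - u) z = val g z - val u z by rewrite linearB.
rewrite !valB (Mu _ _ xy) => h1 h2; rewrite add0r; clear xy.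
have := sqnD_le (val g x - val u y) (val u y - val g y).
rewrite addrA subrK (sqnB (val u y)); move/le_trans; apply.
apply: le_trans (_ : 2 * (c + d) * nsq D (g - u) <= _); first lra.
apply: le_trans (ler_wpM2l _ (ltW h)) _; first lra.
have -> : 2 * (c + d) * (e / 2 / (c + d + 1)) = e * ((c + d) / (c + d + 1)).
  by field; lra.
by rewrite ler_piMr ?(ltW e0)// ler_pdivrMr; lra.
Qed.

Lemma fiber_ksec_in x : M (pk x).
Proof. by case: (hproj_fiberP (ksec H x)). Qed.

Lemma dot_fiber_ksec x h : M h -> D (pk x) h = D (ksec H x) h.
Proof.
move=> Mh; apply/esym/eqP; rewrite -subr_eq0 -dotBl.
by apply/eqP/(proj2 (hproj_fiberP _)).
Qed.

(** The chosen preimages form a partial inverse of [phi], so criteria for the Gram kernel of the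
    projected sections transfer by [psd_extension]. *)
Lemma pushout_kernelE : pushout_kernel H phi =
  extension (fun s => if pselect (exists x, phi x = s) is left hs
                      then Some (projT1 (cid hs)) else None) (gram D pk).
Proof.
apply/funext => s; apply/funext => t; rewrite /pushout_kernel /extension /gram.
by case: pselect => // hs; case: pselect.
Qed.

(* Let [t] be the sum of the [p.1 *: tau (pk p.2) (pk p.2)] and [w] the vector
   with [<Delta f, t> = <f, w>]. Then [w] is a sum of squares of fiber-constant
   functions, hence fiber-constant, so [<ksec x, w> = <pk x, w>]; this gives
   [<t, t> = <Delta u, t>] for the sum [u] of the [p.1 *: pk p.2]. *)
Lemma fiber_gram_rkha : rkha H ->
  exists2 c : R, 0 <= c &
    psd (fun x y => c%:C * gram D pk x y - gram D pk x y ^+ 2).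
Proof.
move=> [T [DT [tau [Delta [[_ tauE _] /bounded_nsq[c c0 hc] Dk]]]]]; exists c => //.
apply/(psd_sub_sqrP _ (psd_gram _ _)) => s.
have -> : (fun x y => gram D pk x y * gram D pk x y) =
    gram DT (fun x => tau (pk x) (pk x)).
  by apply/funext => x; apply/funext => y; rewrite /gram tauE.
rewrite !qn_gram; set t := comb _ s; set u := comb _ s.
have [|a f g|f|w hw _] := riesz (@rkhs_complete _ _ H) (L := fun f => DT (Delta f) t)
  (c := c * nsq DT t).
- by rewrite mulr_ge0 ?nsq_ge0.
- by rewrite linearP dotDl dotZl.
- apply: le_trans (dot_CS _ _ _) _; rewrite mulrAC.
  by rewrite ler_wpM2r ?nsq_ge0.
have tauk z x : DT (tau (ksec H x) (ksec H x)) (tau (pk z) (pk z)) =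
    DT (tau (pk x) (pk x)) (tau (pk z) (pk z)).
  by rewrite !tauE -(dot_fiber_ksec x (fiber_ksec_in z)).
have wE x : DT (tau (pk x) (pk x)) t = D (ksec H x) w.
  rewrite -hw Dk dot_sym [RHS]dot_sym !dot_comb; congr (_^*); apply: eq_bigr => p _.
  by rewrite tauk.
(* [val w x] depends on [x] only through the numbers [D (pk x) (pk z)], conjugates of the values at
   [x] of the fiber-constant [pk z]. *)
have Mw : M w.
  move=> x y xy; rewrite !ksecP dot_sym [RHS]dot_sym -!wE.
  rewrite -!dot_sym /t !dot_comb; congr pair; apply/funext => z.
  rewrite !tauE (_ : D (pk x) (pk z) = D (pk y) (pk z))//.
  have Mz := fiber_ksec_in z.
  by rewrite !dot_fiber_ksec// !(dot_sym _ _ (pk z)) -!ksecP (Mz x y xy).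
have tt : DT t t = DT (Delta u) t.
  rewrite hw /u !dot_comb; apply: eq_bigr => p _; congr (_ * _^*).
  rewrite dot_sym [RHS]dot_sym wE dot_fiber_ksec//.
have := dot_CS DT (Delta u) t; rewrite -tt dotuuE sqnC expr2 => h.
have t0 := nsq_ge0 DT t.
have [tz|tnz] := eqVneq (nsq DT t) 0.
  by rewrite tz mulr_ge0 ?nsq_ge0.
(* Cancels one factor in [(nsq t)^2 <= nsq (Delta u) * nsq t]. *)
apply: le_trans (hc u); rewrite -(ler_pM2r (_ : 0 < nsq DT t))// lt_def tnz//.
Qed.

(** The constant 1 is fiber-constant, so its inner product with [pk x] is its value at [x];
    Cauchy-Schwarz does the rest. *)
Lemma fiber_gram_unital : unital H ->
  exists2 c : R, 0 <= c & forall s, sqn (pair s (fun=> 1)) <= c * qn (gram D pk) s.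
Proof.
rewrite /unital => one; pose e : H := Sub (fun=> 1) one.
have eE : val e = (fun=> 1) by rewrite SubK.
have Me : M e by move=> x y _; rewrite eE.
exists (nsq D e) => [|s]; first exact: nsq_ge0.
rewrite qn_gram mulrC; apply: le_trans (dot_CS _ _ _); rewrite dot_comb.
rewrite le_eqVlt; apply/orP; left; apply/eqP; congr (sqn (pair s _)).
by apply/funext => x; rewrite dot_sym dot_fiber_ksec// -dot_sym -ksecP eE.
Qed.

End Pushout.

(** * Closure properties *)

Section Closure.
Variable R : realType.

Lemma holds_for_psd (X : Type) (K : X -> X -> R[i]) (Q : rkhs R X -> Prop) :
  psd K -> (forall H, kernel H = K -> Q H) -> holds_for_kernel K Q.
Proof. by move=> pK h; split=> //; exact: moore_aronszajn. Qed.

Lemma rkhs_memD (X : Type) (H : rkhs R X) (F G : X -> R[i]) :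
  F \in rkhs_pred H -> G \in rkhs_pred H -> F + G \in rkhs_pred H.
Proof.
move=> HF HG; have := valP ((Sub F HF : H) + (Sub G HG : H)).
by rewrite raddfD /= !SubK.
Qed.

Lemma unitalP (X : Type) (H : rkhs R X) : unital H <->
  exists2 c : R, 0 <= c & psd (fun x y => c%:C * kernel H x y - 1).
Proof.
rewrite /unital; split=> [/mem_rkhsP|] [c c0 pc].
  by exists c => //; move: pc; rewrite conjC1 mulr1.
by apply/mem_rkhsP; exists c => //; rewrite conjC1 mulr1.
Qed.

(** Two telescopings: [c1 c2 k1 k2 - (k1 k2)^2 = (c1 k1 - k1^2) c2 k2 + k1^2 (c2 k2 - k2^2)] and [d1
    d2 k1 k2 - 1 = (d1 k1 - 1) d2 k2 + (d2 k2 - 1)]. *)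
Lemma tensor_closed (X1 X2 : Type) (H1 : rkhs R X1) (H2 : rkhs R X2) :
  rkha H1 -> rkha H2 ->
  holds_for_kernel (tensor_kernel (kernel H1) (kernel H2))
    (fun T => rkha T /\ (unital H1 -> unital H2 -> unital T)).
Proof.
have [p1 p2] := (psd_kernel H1, psd_kernel H2).
move=> /rkhaP[c1 c10 q1] /rkhaP[c2 c20 q2].
apply: holds_for_psd => [|T kT]; first exact: psd_tensor.
split=> [|/unitalP[d1 d10 r1] /unitalP[d2 d20 r2]].
  apply/rkhaP; exists (c1 * c2); rewrite ?mulr_ge0// kT.
  have := psdD (psd_tensor q1 (psdZ c20 p2)) (psd_tensor (psdM p1 p1) q2).
  congr psd; apply/funext => x; apply/funext => y.
  by rewrite /tensor_kernel rmorphM; ring.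
apply/unitalP; exists (d1 * d2); rewrite ?mulr_ge0// kT.
have := psdD (psd_tensor r1 (psdZ d20 p2)) (psd_pullback snd r2).
congr psd; apply/funext => x; apply/funext => y.
by rewrite /tensor_kernel /pullback_kernel rmorphM; ring.
Qed.

Lemma sum_kernelE (X1 X2 : Type) (K1 : X1 -> X1 -> R[i]) (K2 : X2 -> X2 -> R[i]) :
  sum_kernel K1 K2 = (fun x y =>
    extension (fun x => if x is inl x1 then Some x1 else None) K1 x y +
    extension (fun x => if x is inr x2 then Some x2 else None) K2 x y).
Proof.
by apply/funext => -[x|x]; apply/funext => -[y|y]; rewrite /extension /= ?addr0 ?add0r.
Qed.

Lemma psd_sum (X1 X2 : Type) (K1 : X1 -> X1 -> R[i]) (K2 : X2 -> X2 -> R[i]) :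
  psd K1 -> psd K2 -> psd (sum_kernel K1 K2).
Proof.
by move=> p1 p2; rewrite sum_kernelE; apply: psdD; exact: psd_extension.
Qed.

Lemma sum_closed (X1 X2 : Type) (H1 : rkhs R X1) (H2 : rkhs R X2) :
  rkha H1 -> rkha H2 ->
  holds_for_kernel (sum_kernel (kernel H1) (kernel H2))
    (fun T => rkha T /\ (unital H1 -> unital H2 -> unital T)).
Proof.
have [p1 p2] := (psd_kernel H1, psd_kernel H2).
move=> /rkhaP[c1 c10 q1] /rkhaP[c2 c20 q2].
apply: holds_for_psd => [|T kT]; first exact: psd_sum.
split=> [|/unitalP[d1 d10 r1] /unitalP[d2 d20 r2]].
  apply/rkhaP; exists (c1 + c2); rewrite ?addr_ge0// kT.
  have := psd_sum (psdD q1 (psdZ c20 p1)) (psdD q2 (psdZ c10 p2)).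
  congr psd; apply/funext => -[x|x]; apply/funext => -[y|y] /=; rewrite ?rmorphD; ring.
rewrite /unital.
(* The rank-one kernel of 1 has nonzero entries between the summands, where the sum kernel is 0; the
   two indicators stay inside their blocks. *)
have -> : (fun=> 1 : R[i]) = (fun x : X1 + X2 => if x is inl _ then 1 else 0 : R[i])
    + (fun x => if x is inr _ then 1 else 0).
  by apply/funext => -[x|x]; rewrite /GRing.add /= ?addr0 ?add0r.
apply: rkhs_memD; apply/mem_rkhsP.
  exists d1 => //; rewrite kT; have := psd_sum r1 (psdZ d10 p2).
  congr psd; apply/funext => -[x|x]; apply/funext => -[y|y] /=;
    rewrite ?conjC1 ?conjC0; ring.
exists d2 => //; rewrite kT; have := psd_sum (psdZ d20 p1) r2.
congr psd; apply/funext => -[x|x]; apply/funext => -[y|y] /=;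
  rewrite ?conjC1 ?conjC0; ring.
Qed.

Lemma pullback_closed (X S : Type) (H : rkhs R X) (phi : S -> X) :
  rkha H ->
  holds_for_kernel (pullback_kernel phi (kernel H))
    (fun T => rkha T /\ (unital H -> unital T)).
Proof.
move=> /rkhaP[c c0 q].
apply: holds_for_psd => [|T kT]; first exact/psd_pullback/psd_kernel.
split=> [|/unitalP[d d0 r]].
  by apply/rkhaP; exists c => //; rewrite kT; exact: psd_pullback q.
by apply/unitalP; exists d => //; rewrite kT; exact: psd_pullback r.
Qed.

(** Off the range of [phi] the kernel vanishes, and with it every function of [T]. So 1 is pushed to
    the indicator of the range, and 1 itself lies in [T] only for surjective [phi]: hence two unital
    clauses. *)
Lemma pushout_closed (X S : Type) (H : rkhs R X) (phi : X -> S) :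
  rkha H ->
  holds_for_kernel (pushout_kernel H phi)
    (fun T => [/\ rkha T,
       (unital H -> (fun s => (s \in range phi)%:R) \in rkhs_pred T) &
       (unital H -> range phi = setT -> unital T)]).
Proof.
move=> /(fiber_gram_rkha phi)[c c0 q].
have pG : psd (gram (rkhs_dot H) (fiber_ksec H phi)) by exact: psd_gram.
rewrite pushout_kernelE; set ph := (fun s => _).
apply: holds_for_psd => [|T kT]; first exact: psd_extension.
have range_mem : unital H -> (fun s => (s \in range phi)%:R) \in rkhs_pred T.
  move=> /(fiber_gram_unital phi)[d d0 /(psd_sub_rank1 _ _ pG.1) r].
  apply/mem_rkhsP; exists d => //; rewrite kT.
  (* Extended by zero, the constant 1 subtracted in [r] becomes the rank-one kernel of the
     indicator. *)
  have := psd_extension ph r; congr psd.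
  have phE s : (s \in range phi) = ph s :> bool.
    rewrite /ph; case: pselect => [[x xs]|nx] /=; first by apply/mem_set; exists x.
    by apply/memNset => -[x _ xs]; apply: nx; exists x.
  apply/funext => s; apply/funext => t; rewrite !phE /extension.
  case: (ph s) (ph t) => [x|] [y|] //=; rewrite ?conjC0; ring.
split=> //.
  apply/rkhaP; exists c => //; rewrite kT.
  have := psd_extension ph q; congr psd.
  apply/funext => s; apply/funext => t; rewrite /extension.
  case: (ph s) (ph t) => [x|] [y|] //=; ring.
move=> /range_mem + rT; rewrite /unital rT.
by rewrite (_ : (fun s => _) = (fun=> 1))//; apply/funext => s; rewrite in_setT.
Qed.

End Closure.

Theorem proposition3p1 (R : realType) :
  (forall (X1 X2 : Type) (H1 : rkhs R X1) (H2 : rkhs R X2),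
     rkha H1 -> rkha H2 ->
     holds_for_kernel (tensor_kernel (kernel H1) (kernel H2))
       (fun T => rkha T /\ (unital H1 -> unital H2 -> unital T)) /\
     holds_for_kernel (sum_kernel (kernel H1) (kernel H2))
       (fun T => rkha T /\ (unital H1 -> unital H2 -> unital T))) /\
  (forall (X S : Type) (H : rkhs R X) (phi : S -> X),
     rkha H ->
     holds_for_kernel (pullback_kernel phi (kernel H))
       (fun T => rkha T /\ (unital H -> unital T))) /\
  (forall (X S : Type) (H : rkhs R X) (phi : X -> S),
     rkha H ->
     holds_for_kernel (pushout_kernel H phi)
       (fun T => [/\ rkha T,
          (unital H -> (fun s => (s \in range phi)%:R) \in rkhs_pred T) &
          (unital H -> range phi = setT -> unital T)])).
Proof.
split; last by split=> X S H phi; [exact: pullback_closed | exact: pushout_closed].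
by move=> X1 X2 H1 H2 r1 r2; split; [exact: tensor_closed | exact: sum_closed].
Qed.
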